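(* The constant $\mathfrak{M}(1)=\sum_{n=1}^{\infty}\frac{d_n}{n}$ is given by the convergent series $$\mathfrak{M}(1)=\sum_{n=1}^{\infty}\frac{(\zeta(2n)-1)\cdot m_{2n}}{n}-3\sum_{n=1}^{\infty}\frac{m_{n}}{n\cdot 2^{n}}-\log\pi+\log 4.$$
   Context: The Minkowski question mark function $?:[0,1]\to[0,1]$ is defined by $$?([0,a_{1},a_{2},a_{3},\ldots])=2\sum_{i=1}^{\infty}(-1)^{i+1}2^{-\sum_{j=1}^{i}a_{j}},$$ where $x=[0,a_1,a_2,a_3,\ldots]$ is the regular continued fraction of $x$ (for rational $x$ the expansion is finite and the sum is finite). It is continuous and strictly increasing. Its Fourier-Stieltjes coefficients and moments are $$d_n=\int_0^1\cos(2\pi n x)\,\mathrm{d}?(x)\quad(n\ge 1),\qquad m_{L}=\int_0^1 x^{L}\,\mathrm{d}?(x)\quad(L\ge 0).$$ $\mathfrak{M}(s)=\sum_{n\ge1}d_n n^{-s}$ is the associated Dirichlet series, and $\zeta$ is the Riemann zeta function. *)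

(* Defs.v *)
From HB Require Import structures.
From mathcomp Require Import all_boot all_order all_algebra.
From mathcomp Require Import ring lra.
From mathcomp Require Import all_classical all_reals all_analysis.

Set Implicit Arguments.
Unset Strict Implicit.
Unset Printing Implicit Defensive.

Import Order.TTheory GRing.Theory Num.Theory.
Import numFieldNormedType.Exports.

Local Open Scope classical_set_scope.
Local Open Scope ring_scope.

Section question_mark.
Variable R : realType.
Implicit Types (x y : R) (n i : nat).

(* x |-> frac(1/x); it sends 0 to 0 since 0^-1 = 0 *)
Definition gauss_map x : R := x^-1 - (Num.truncn x^-1)%:R.

(* Regular continued fraction x = [0, a_1, a_2, ...] of x in [0, 1]:
   [partial_quotient x i] is a_(i+1).  The expansion stops as soon as an iterate
   of the Gauss map vanishes, so a_(i+1) exists iff the i-th iterate is nonzero;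
   in particular the expansion of 0 is empty, and that of 1 is [0, 1]. *)
Definition partial_quotient x i : nat := Num.truncn (iter i gauss_map x)^-1.

(* with indices shifted by one, so that (-1)^(i+1) becomes (-1)^i *)
Definition question_mark_term x i : R :=
  if iter i gauss_map x == 0 then 0
  else (-1) ^+ i * 2 ^- (\sum_(j < i.+1) partial_quotient x j).

Definition question_mark x : R := 2 * limn (series (question_mark_term x)).

(* extension of ?, constant on ]-oo, 0] and on [1, +oo[, so as to define d? *)
Definition question_mark_ext x : R := question_mark (Num.max 0 (Num.min x 1)).

Definition itv01 x := 0 <= x <= 1.

Lemma gauss_mapP x : 0 < x <= 1 ->
  [/\ (0 < partial_quotient x 0)%N, 0 <= gauss_map x < 1 &
      x = ((partial_quotient x 0)%:R + gauss_map x)^-1].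
Proof.
move=> /andP[x0 x1]; rewrite /partial_quotient /gauss_map/=.
have xV1 : 1 <= x^-1 by rewrite -invr1 lef_pV2 ?posrE.
have /andP[lo hi] := truncn_itv (le_trans ler01 xV1).
split; first by rewrite truncn_gt0.
  by rewrite subr_ge0 lo/= ltrBlDr addrC natr1.
by rewrite addrC subrK invrK.
Qed.

Lemma gauss_mapV (a : nat) (t : R) : (0 < a)%N -> 0 <= t < 1 ->
  [/\ 0 < (a%:R + t)^-1 <= 1, partial_quotient (a%:R + t)^-1 0 = a &
      gauss_map (a%:R + t)^-1 = t].
Proof.
move=> a0 /andP[t0 t1].
have a1 : (1 : R) <= a%:R by rewrite ler1n.
have at1 : 1 <= a%:R + t by lra.
have tr : Num.truncn (a%:R + t) = a.
  by apply: truncn_def; rewrite -natr1 lerDl ltrD2l t0 t1.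
rewrite /partial_quotient /gauss_map/= invrK tr; split => //.
  by rewrite invr_gt0 invf_le1 ?at1 ?andbT //; lra.
by rewrite addrC addKr.
Qed.

Lemma gauss_map01 x : itv01 x -> itv01 (gauss_map x).
Proof.
rewrite /itv01 => /andP[x0 x1]; have [->|xn0] := eqVneq x 0.
  by rewrite /gauss_map invr0 truncn0 subrr lexx ler01.
have [|_ /andP[-> /ltW->] _] := gauss_mapP (x := x); last by [].
by rewrite lt0r xn0 x0.
Qed.

Lemma question_mark_termS x i : x != 0 ->
  question_mark_term x i.+1 =
  - (2 ^- partial_quotient x 0 * question_mark_term (gauss_map x) i).
Proof.
move=> x0; rewrite /question_mark_term iterSr.
case: ifP => _; first by rewrite mulr0 oppr0.
rewrite big_ord_recl/=.
under eq_bigr => j _.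
  rewrite (_ : partial_quotient x _ = partial_quotient (gauss_map x) j); last first.
    by rewrite /partial_quotient /bump leq0n add1n iterSr.
  over.
rewrite exprD invfM exprS; ring.
Qed.

Lemma question_mark_term0 i : question_mark_term 0 i = 0.
Proof.
rewrite /question_mark_term; suff -> : iter i gauss_map 0 = 0 by rewrite eqxx.
by elim: i => //= i ->; rewrite /gauss_map invr0 truncn0 subrr.
Qed.

Definition question_mark_sum x n : R := 2 * series (question_mark_term x) n.

Lemma question_mark_sum0 n : question_mark_sum 0 n = 0.
Proof.
rewrite /question_mark_sum seriesEnat/= big1 ?mulr0// => i _.
by rewrite question_mark_term0.
Qed.

Lemma question_mark_sumS x n : x != 0 ->
  question_mark_sum x n.+1 =
  2 ^- partial_quotient x 0 * (2 - question_mark_sum (gauss_map x) n).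
Proof.
move=> x0; rewrite /question_mark_sum !seriesEord/= big_ord_recl.
rewrite (eq_bigr (fun i : 'I_n =>
    - (2 ^- partial_quotient x 0 * question_mark_term (gauss_map x) i))); last first.
  by move=> i _; rewrite lift0 question_mark_termS.
rewrite sumrN -mulr_sumr {1}/question_mark_term /= (negbTE x0).
rewrite big_ord1 expr0 mul1r; ring.
Qed.

Lemma exp2V_le (a b : nat) : (a <= b)%N -> (2 : R) ^- b <= 2 ^- a.
Proof. by move=> ab; rewrite lef_pV2 ?posrE ?exprn_gt0// ler_eXn2l ?ltr1n. Qed.

Lemma exp2V_gt0 (a : nat) : 0 < (2 : R) ^- a.
Proof. by rewrite invr_gt0 exprn_gt0. Qed.

Lemma exp2VS (a : nat) : 2 * (2 : R) ^- a.+1 = 2 ^- a.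
Proof. by rewrite exprS invfM mulrA divff ?mul1r. Qed.

Lemma question_mark_sum01 x n : itv01 x -> itv01 (question_mark_sum x n).
Proof.
elim: n x => [|n IH] x x01.
  by rewrite /question_mark_sum seriesEnat/= big_geq// mulr0 /itv01 lexx ler01.
have [->|xn0] := eqVneq x 0; first by rewrite question_mark_sum0 /itv01 lexx ler01.
have /andP[x0 x1] := x01.
have [|a0 _ _] := gauss_mapP (x := x); first by rewrite lt0r xn0 x0.
have /andP[s0 s1] := IH _ (gauss_map01 x01).
rewrite question_mark_sumS// /itv01; move: a0; case: (partial_quotient x 0) => // a _.
have p0 := exp2V_gt0 a.+1; have pS := exp2VS a.
have := exp2V_le (leq0n a); rewrite expr0 invr1 => p1.
by apply/andP; split; nra.
Qed.

Lemma partial_quotient_le x y : 0 < x -> x <= y ->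
  (partial_quotient y 0 <= partial_quotient x 0)%N.
Proof.
move=> x0 xy; apply: le_truncn => /=.
by rewrite lef_pV2 ?posrE//; exact: lt_le_trans xy.
Qed.

Lemma question_mark_sum_le n x y : itv01 x -> itv01 y -> x <= y ->
  question_mark_sum x n <= question_mark_sum y n.
Proof.
elim: n x y => [|n IH] x y x01 y01 xy.
  by rewrite /question_mark_sum !seriesEnat/= !big_geq.
have [->|xn0] := eqVneq x 0; first by
  rewrite question_mark_sum0; case/andP: (question_mark_sum01 n.+1 y01).
have /andP[x0 x1] := x01; have {}x0 : 0 < x by rewrite lt0r xn0.
have y0 : 0 < y by exact: lt_le_trans xy.
have /andP[_ y1] := y01.
rewrite !question_mark_sumS ?gt_eqF//.
have /andP[sx0 sx1] := question_mark_sum01 n (gauss_map01 x01).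
have /andP[sy0 sy1] := question_mark_sum01 n (gauss_map01 y01).
have [] := gauss_mapP (x := x); rewrite ?x0// => _ /andP[t0 t1] ex.
have [] := gauss_mapP (x := y); rewrite ?y0// => ay0 /andP[u0 u1] ey.
have := partial_quotient_le x0 xy; rewrite leq_eqVlt => /predU1P[e|alt].
  rewrite e ler_pM2l// lerD2l lerN2; apply: IH; rewrite ?gauss_map01//.
  move: xy; rewrite {1}ex {1}ey -e lef_pV2 ?posrE; first by rewrite lerD2l.
    by rewrite ltr_wpDr// ltr0n.
  by rewrite ltr_wpDr// ltr0n.
move: alt; case: (partial_quotient x 0) => // a; rewrite ltnS => /exp2V_le.
have := exp2VS a; have := exp2V_gt0 a.+1; have := exp2V_gt0 (partial_quotient y 0).
move: ((2 : R) ^- a.+1) ((2 : R) ^- a) ((2 : R) ^- partial_quotient y 0) => p q r *; nra.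
Qed.

Lemma question_mark_term_bound x i : itv01 x ->
  `|question_mark_term x i| <= 2 ^- i.+1.
Proof.
elim: i x => [|i IH] x x01.
  rewrite /question_mark_term/=; case: ifPn => xn0.
    by rewrite normr0 ltW.
  have /andP[x0 x1] := x01.
  have [|a0 _ _] := gauss_mapP (x := x); first by rewrite lt0r xn0 x0.
  by rewrite big_ord1 expr0 mul1r ger0_norm ?exp2V_le// ltW.
have [->|xn0] := eqVneq x 0; first by rewrite question_mark_term0 normr0 ltW.
have /andP[x0 x1] := x01.
have [|a0 _ _] := gauss_mapP (x := x); first by rewrite lt0r xn0 x0.
rewrite question_mark_termS// normrN normrM (ger0_norm (ltW (exp2V_gt0 _))).
have := IH _ (gauss_map01 x01); have := exp2V_le a0; rewrite expr1.
have := normr_ge0 (question_mark_term (gauss_map x) i).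
have := exp2V_gt0 (partial_quotient x 0); rewrite (exprS _ i.+1) invfM.
move: ((2 : R) ^- partial_quotient x 0) (`|_|) ((2 : R) ^- i.+1) => p q r *; nra.
Qed.

Lemma is_cvg_question_mark x : itv01 x -> cvgn (series (question_mark_term x)).
Proof.
move=> x01; apply: normed_cvg.
apply: (@series_le_cvg _ _ (geometric (2^-1) (2^-1))) => [n|n|n|] /=.
- exact: normr_ge0.
- by rewrite mulr_ge0// exprn_ge0.
- by have := question_mark_term_bound n x01; rewrite exprS invfM exprVn.
- by apply: is_cvg_geometric_series; rewrite ger0_norm; lra.
Qed.

Lemma cvg_question_mark_sum x : itv01 x -> question_mark_sum x @ \oo --> question_mark x.
Proof. by move=> x01; apply: cvgMl_tmp; exact: is_cvg_question_mark. Qed.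

Lemma question_mark01 x : itv01 x -> itv01 (question_mark x).
Proof.
move=> x01; have c := cvg_question_mark_sum x01; have cc := cvgP _ c.
apply/andP; split; rewrite -(cvg_lim _ c)//.
  by apply: limr_ge => //; near=> n; case/andP: (question_mark_sum01 n x01).
by apply: limr_le => //; near=> n; case/andP: (question_mark_sum01 n x01).
Unshelve. all: by end_near. Qed.

Lemma question_mark_le x y : itv01 x -> itv01 y -> x <= y ->
  question_mark x <= question_mark y.
Proof.
move=> x01 y01 xy; have cx := cvg_question_mark_sum x01.
have cy := cvg_question_mark_sum y01.
rewrite -(cvg_lim _ cx)// -(cvg_lim _ cy)//.
apply: ler_lim; [exact: cvgP cx|exact: cvgP cy|].
by near=> n; exact: question_mark_sum_le.
Unshelve. all: by end_near. Qed.

Lemma question_mark0 : question_mark 0 = 0.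
Proof.
have c := cvg_question_mark_sum (_ : itv01 0); rewrite -(cvg_lim _ (c _))//; last first.
  by rewrite /itv01 lexx ler01.
rewrite (_ : question_mark_sum 0 = cst 0) ?lim_cst//.
by apply/funext => n; rewrite question_mark_sum0.
Qed.

Lemma question_markE x : 0 < x <= 1 ->
  question_mark x = 2 ^- partial_quotient x 0 * (2 - question_mark (gauss_map x)).
Proof.
move=> /andP[x0 x1]; have x01 : itv01 x by rewrite /itv01 ltW.
have c := cvg_question_mark_sum x01; rewrite -(cvg_shiftS (question_mark_sum x)) in c.
rewrite -(cvg_lim _ c)//; apply/cvg_lim => //.
rewrite (_ : (fun n => question_mark_sum x n.+1) =
  (fun n => 2 ^- partial_quotient x 0 * (2 - question_mark_sum (gauss_map x) n))); last first.
  by apply/funext => n; rewrite question_mark_sumS// gt_eqF.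
apply: cvgMl_tmp; apply: cvgB; first exact: cvg_cst.
by apply: cvg_question_mark_sum; exact: gauss_map01.
Qed.

Lemma question_mark1 : question_mark 1 = 1.
Proof.
have [] := @gauss_mapV 1 0 isT; first by rewrite lexx ltr01.
rewrite addr0 invr1 => h a g.
by rewrite question_markE// a g question_mark0 subr0 expr1 mulVf.
Qed.

Lemma question_mark_approx n :
  (forall x, 0 <= x < 1 -> exists2 y, x < y <= 1 &
     question_mark y <= question_mark x + 2 ^- n) /\
  (forall x, 0 < x <= 1 -> exists2 y, 0 <= y < x &
     question_mark x - 2 ^- n <= question_mark y).
Proof.
elim: n => [|n [IHr IHl]].
  split=> x /andP[x0 x1].
    exists 1; first by rewrite x1 lexx.
    have /andP[q0 q1] : itv01 (question_mark x).
      by apply: question_mark01; rewrite /itv01 x0 ltW.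
    by rewrite question_mark1 expr0 invr1 lerDr.
  exists 0; first by rewrite lexx x0.
  have /andP[q0 q1] : itv01 (question_mark x).
    by apply: question_mark01; rewrite /itv01 x1 ltW.
  by rewrite question_mark0 expr0 invr1 subr_le0.
split=> x /andP[x0 x1].
- have [->|xn0] := eqVneq x 0.
    have [|h a g] := @gauss_mapV n.+2 0 isT; first by rewrite lexx ltr01.
    exists (n.+2%:R + 0)^-1; first exact: h.
    rewrite question_markE// a g question_mark0 subr0 add0r.
    by rewrite mulrC exp2VS.
  have {}x0 : 0 < x by rewrite lt0r xn0.
  have x01 : 0 < x <= 1 by rewrite x0 ltW.
  have [] := gauss_mapP x01; have := question_markE x01.
  move: (partial_quotient x 0) (gauss_map x) => a t qx a0 /andP[t0 t1] ex.
  have [tz|tn0] := eqVneq t 0.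
    rewrite {}tz addr0 question_mark0 subr0 in qx ex *.
    move: a a0 qx ex => [//|[|a]] _ qx ex.
      by move: x1; rewrite ex invr1 ltxx.
    have [|s /andP[s0 s1] qs] := IHl 1; first by rewrite ltr01 lexx.
    have [|h b g] := @gauss_mapV a.+1 s isT; first by rewrite s0 s1.
    exists (a.+1%:R + s)^-1.
      have /andP[_ ->] := h; rewrite andbT ex ltf_pV2 ?posrE ?ltr0n//.
        by rewrite -(natr1 a.+1) ltrD2l.
      by rewrite ltr_wpDr ?ltr0n.
    rewrite question_markE// b g qx.
    move: qs; rewrite question_mark1 [2 ^- a.+2 * 2]mulrC exp2VS => qs.
    have p1 : (2 : R) ^- a.+1 <= 2^-1 by rewrite -[leRHS]expr1 exprVn; exact: exp2V_le.
    have p0 := exp2V_gt0 a.+1; have r0 := exp2V_gt0 n.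
    have := exp2VS n; move: p1 p0 r0 qs.
    move: ((2 : R) ^- a.+1) ((2 : R) ^- n) ((2 : R) ^- n.+1) => p r r' *; nra.
  have {}t0 : 0 < t by rewrite lt0r tn0.
  have [|s /andP[s0 st] qs] := IHl t; first by rewrite t0 ltW.
  have s1 := lt_trans st t1.
  have [|h b g] := @gauss_mapV a s a0; first by rewrite s0 s1.
  exists (a%:R + s)^-1.
    have /andP[_ ->] := h; rewrite andbT ex ltf_pV2 ?posrE ?ltrD2l//.
      by rewrite ltr_wpDr ?ltr0n// ltW.
    by rewrite ltr_wpDr ?ltr0n.
  rewrite question_markE// b g qx.
  have p1 : (2 : R) ^- a <= 2^-1 by rewrite -[leRHS]expr1 exprVn; exact: exp2V_le.
  have p0 := exp2V_gt0 a; have r0 := exp2V_gt0 n.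
  have := exp2VS n; move: p1 p0 r0 qs.
  move: ((2 : R) ^- a) ((2 : R) ^- n) ((2 : R) ^- n.+1) => p r r' *; nra.
- have x01 : 0 < x <= 1 by rewrite x0.
  have [] := gauss_mapP x01; have := question_markE x01.
  move: (partial_quotient x 0) (gauss_map x) => a t qx a0 /andP[t0 t1] ex.
  have [|s' /andP[ts' s'1] qs'] := IHr t; first by rewrite t0 t1.
  pose s := Num.min s' ((1 + t) / 2).
  have ts : t < s by rewrite lt_min ts'/=; lra.
  have s0 : 0 <= s by lra.
  have s1 : s < 1 by rewrite gt_min; apply/orP; right; lra.
  have qs : question_mark s <= question_mark t + 2 ^- n.
    apply: le_trans qs'; apply: question_mark_le.
    - by rewrite /itv01 s0 ltW.
    - by rewrite /itv01 s'1 andbT; lra.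
    - by rewrite /s ge_min lexx.
  have [|h b g] := @gauss_mapV a s a0; first by rewrite s0 s1.
  exists (a%:R + s)^-1.
    have /andP[/ltW-> _] := h; rewrite /= ex ltf_pV2 ?posrE ?ltrD2l//.
      by rewrite ltr_wpDr ?ltr0n.
    by rewrite ltr_wpDr ?ltr0n.
  rewrite (question_markE h) b g qx.
  have p1 : (2 : R) ^- a <= 2^-1 by rewrite -[leRHS]expr1 exprVn; exact: exp2V_le.
  have p0 := exp2V_gt0 a; have r0 := exp2V_gt0 n.
  have := exp2VS n; move: p1 p0 r0 qs.
  move: ((2 : R) ^- a) ((2 : R) ^- n) ((2 : R) ^- n.+1) => p r r' *; nra.
Qed.

Lemma clamp01 x : itv01 (Num.max 0 (Num.min x 1)).
Proof. by rewrite /itv01 le_max lexx/= ge_max ler01/= ge_min lexx orbT. Qed.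

Lemma question_mark_ext_nd : {homo question_mark_ext : x y / x <= y}.
Proof.
move=> x y xy; apply: question_mark_le; rewrite ?clamp01//.
rewrite ge_max le_max lexx/= le_max; apply/orP; right.
by rewrite le_min !ge_min xy lexx orbT.
Qed.

Lemma question_mark_ext_rc : right_continuous question_mark_ext.
Proof.
move=> x; apply/cvgrPdist_le => e e0.
have [n ne] : exists n, (2 : R) ^- n <= e.
  exists (Num.truncn e^-1); rewrite -[leRHS]invrK lef_pV2 ?posrE ?exprn_gt0 ?invr_gt0//.
  have eV0 : 0 <= e^-1 by rewrite invr_ge0 ltW.
  have /andP[_ /ltW/le_trans] := truncn_itv eV0; apply.
  by rewrite -natrX ler_nat ltn_expl.
have [z xz qz] : exists2 z, x < z &
    question_mark_ext z <= question_mark_ext x + 2 ^- n.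
  rewrite /question_mark_ext; have [x0|x0] := ltP x 0.
    exists 0 => //; rewrite (min_l (@ler01 R)) maxxx.
    by rewrite max_l ?ge_min ?(ltW x0)// lerDl ltW.
  have [x1|x1] := ltP x 1; last first.
    by exists (x + 1); rewrite ?ltrDl// !min_r ?lerDl ?ltW//; lra.
  have [|z /andP[xz z1] qz] := (question_mark_approx n).1 x; first by rewrite x0.
  have clampE (u : R) : 0 <= u -> u <= 1 -> Num.max 0 (Num.min u 1) = u.
    by move=> u0 u1; rewrite min_l// max_r.
  have z0 : 0 <= z := le_trans x0 (ltW xz).
  exists z; first exact: xz.
  by rewrite (clampE z)// max_r.
near=> y.
have xy : x < y by near: y; exact: nbhs_right_gt.
have yz : y < z by near: y; exact: nbhs_right_lt.
have := question_mark_ext_nd (ltW xy); have := question_mark_ext_nd (ltW yz).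
by move=> h1 h2; rewrite ler0_norm; lra.
Unshelve. all: by end_near. Qed.


HB.instance Definition _ := isCumulative.Build R _ R question_mark_ext
  question_mark_ext_nd question_mark_ext_rc.

Definition question_mark_measure : {measure set (measurableTypeR R) -> \bar R} :=
  lebesgue_stieltjes_measure question_mark_ext.

Definition fourier_coef n : R :=
  \int[question_mark_measure]_(x in `[0, 1]) cos (2 * pi * n%:R * x).

Definition moment n : R := \int[question_mark_measure]_(x in `[0, 1]) x ^+ n.

(* the Dirichlet series, for real s *)
Definition dirichlet_M (s : R) : R :=
  limn (series (fun n => fourier_coef n.+1 * n.+1%:R `^ (- s))).

End question_mark.

(* meaningful for s > 1 only *)
Definition zeta {R : realType} (s : R) : R :=
  limn (series (fun n => n.+1%:R `^ (- s))).

Arguments dirichlet_M {R} s.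
Arguments moment {R} n.
Arguments fourier_coef {R} n.

(* Main.v *)
From HB Require Import structures.
Require Import Defs.
From mathcomp Require Import all_boot all_order all_algebra.
From mathcomp Require Import ring lra.
From mathcomp Require Import all_classical all_reals all_analysis measurable_realfun.

(** The Fourier series - ln (2 sin (pi x)) = sum_(n >= 1) cos (2 pi n x) / n turns
    the constant into - S, where S is the integral of ln (2 sin (pi x)) against d?.
    Termwise integration is legitimate because the N-th partial sum is within
    4 (1/x + 1/(1-x)) / (N+1) of its limit (cos_series_bound, inv_sin_le), and 1/x
    is integrable against d? since ?(1/k) = 2^(1-k) decays exponentially
    (qm_integrable_inv).

    Euler's product splits the same logarithm differently:
    - ln (sin (pi x)) is - ln (pi x) - ln (1 - x) - ln (1 + x) plus
    - sum_(k >= 2) ln (1 - x^2 / k^2). Expanding the last sum in powers of x^2 gives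
    sum_n (zeta (2 n) - 1) x^(2 n) / n with nonnegative coefficients
    (cvg_ln_sinc_tail), and monotone convergence produces the moments. The product
    itself comes from the recurrence of the integrals of cos^n t cos (2 x t) over
    [0, pi / 2] (wallisSS).

    What remains are the integrals against d? of ln x, ln (1 - x) and ln (1 + x).
    The functional equations of ? say that d? is invariant under x |-> 1 - x and
    under the Farey tent map T. Since ln x + ln (1 - x) = ln (T x) - 2 ln (1 + T x),
    with I and J the integrals of ln x and ln (1 + x), invariance gives
    2 I = I - 2 J, so I = - 2 J (qm_integral_ln). Finally the series of the
    m_n / (n 2^n) is the integral of - ln (1 - x / 2), that is ln 2 - J. Eliminating
    J between the two series gives the formula. *)

Set Implicit Arguments.
Unset Strict Implicit.
Unset Printing Implicit Defensive.

Import Order.TTheory GRing.Theory Num.Theory.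
Import numFieldNormedType.Exports.

Local Open Scope classical_set_scope.
Local Open Scope ring_scope.

(** * Derivatives and the logarithmic series *)

Section derivatives.
Context {R : realType}.
Implicit Types (f g : R -> R) (x a b c : R).

Lemma is_derive_addf f g x a b : is_derive x 1 f a -> is_derive x 1 g b ->
  is_derive x 1 (fun t => f t + g t) (a + b).
Proof. by move=> df dg; exact: (is_deriveD df dg). Qed.

Lemma is_derive_oppf f x a : is_derive x 1 f a ->
  is_derive x 1 (fun t => - f t) (- a).
Proof. by move=> df; exact: (is_deriveN df). Qed.

Lemma is_derive_mulf f g x a b : is_derive x 1 f a -> is_derive x 1 g b ->
  is_derive x 1 (fun t => f t * g t) (f x * b + g x * a).
Proof. by move=> df dg; exact: (is_deriveM df dg). Qed.

Lemma is_derive_expf f n x a : is_derive x 1 f a ->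
  is_derive x 1 (fun t => f t ^+ n) (n%:R * f x ^+ n.-1 * a).
Proof.
move=> df; have := is_deriveX n df.
by rewrite (_ : f ^+ n = fun t => f t ^+ n)// funeqE => t; rewrite exprfctE.
Qed.

Lemma is_derive_sumf n (h : 'I_n -> R -> R) (dh : 'I_n -> R) x :
  (forall i, is_derive x 1 (h i) (dh i)) ->
  is_derive x 1 (fun t => \sum_(i < n) h i t) (\sum_(i < n) dh i).
Proof.
move=> dhP; have := @is_derive_sum _ _ _ n h x 1 dh dhP.
by rewrite (_ : \sum_(i < n) h i = fun t => \sum_(i < n) h i t)// funeqE => t;
  rewrite fct_sumE.
Qed.

Lemma is_derive_sinf f x a : is_derive x 1 f a ->
  is_derive x 1 (fun t => sin (f t)) (cos (f x) * a).
Proof. by move=> df; exact: (is_derive1_comp (is_derive_sin (f x)) df). Qed.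

Lemma is_derive_cosf f x a : is_derive x 1 f a ->
  is_derive x 1 (fun t => cos (f t)) (- sin (f x) * a).
Proof. by move=> df; exact: (is_derive1_comp (is_derive_cos (f x)) df). Qed.

Lemma is_derive_lnf f x a : 0 < f x -> is_derive x 1 f a ->
  is_derive x 1 (fun t => ln (f t)) ((f x)^-1 * a).
Proof. by move=> f0 df; exact: (is_derive1_comp (is_derive1_ln f0) df). Qed.

Lemma is_derive_invf f x a : f x != 0 -> is_derive x 1 f a ->
  is_derive x 1 (fun t => (f t)^-1) (- (f x) ^- 2 * a).
Proof. by move=> f0 df; exact: (is_deriveV f0 df). Qed.

Lemma is_derive_cstf a x : is_derive x 1 (fun=> a) 0.
Proof. exact: is_derive_cst. Qed.

Lemma is_derive_idf x : is_derive x 1 (fun t => t) 1.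
Proof. exact: is_derive_id. Qed.

Lemma is_derive_continuous f x a : is_derive x 1 f a -> {for x, continuous f}.
Proof.
move=> df; apply: differentiable_continuous.
by apply/derivable1_diffP; exact: ex_derive.
Qed.

Lemma is_derive_derive1 f x a : is_derive x 1 f a -> (f^`())%classic x = a.
Proof. by move=> df; rewrite derive1E; exact: derive_val. Qed.

Lemma ge0_is_derive_le (f df : R -> R) a b : a <= b ->
  (forall x, a <= x <= b -> is_derive x 1 f (df x)) ->
  (forall x, a <= x <= b -> 0 <= df x) -> f a <= f b.
Proof.
move=> ab fdf df0; apply: (@ger0_derive1_ndecr R f a b) => //.
- move=> x; rewrite in_itv/= => /andP[/ltW ax /ltW xb].
  have h : is_derive x 1 f (df x) by apply: fdf; rewrite ax.
  exact: ex_derive.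
- move=> x; rewrite in_itv/= => /andP[/ltW ax /ltW xb].
  have h : is_derive x 1 f (df x) by apply: fdf; rewrite ax.
  by rewrite (is_derive_derive1 h) df0// ax.
- apply: derivable_within_continuous => x; rewrite in_itv/= => xab.
  have h := fdf _ xab; exact: ex_derive.
Qed.

(** Both g - f and g + f are nondecreasing. This form of the mean value
    inequality gives the remainders of the logarithmic and of the Fourier series. *)
Lemma norm_is_derive_le (f g df dg : R -> R) a b : a <= b ->
  (forall x, a <= x <= b -> is_derive x 1 f (df x)) ->
  (forall x, a <= x <= b -> is_derive x 1 g (dg x)) ->
  (forall x, a <= x <= b -> `|df x| <= dg x) -> `|f b - f a| <= g b - g a.
Proof.
move=> ab fdf gdg dfg; rewrite ler_norml; apply/andP; split.
- suff : g a + f a <= g b + f b by lra.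
  apply: (@ge0_is_derive_le (fun t => g t + f t) (fun t => dg t + df t)) => //.
    by move=> x xab; apply: is_derive_addf; [exact: gdg|exact: fdf].
  by move=> x xab; have := dfg x xab; rewrite ler_norml => /andP[]; lra.
- suff : g a - f a <= g b - f b by lra.
  apply: (@ge0_is_derive_le (fun t => g t - f t) (fun t => dg t - df t)) => //.
    move=> x xab; apply: is_derive_addf; first exact: gdg.
    by apply: is_derive_oppf; exact: fdf.
  by move=> x xab; have := dfg x xab; rewrite ler_norml => /andP[]; lra.
Qed.

End derivatives.

(** Rules are applied by the shape of the function only: with type class
    resolution the instances for functions would answer first, with derivatives
    written as scalings. *)
Ltac derivation :=
  notypeclasses refine (is_derive_eq _ _);
  [ repeat first
    [ exact: is_derive_cstf
    | exact: is_derive_idf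
    | exact: is_derive_sin
    | exact: is_derive_cos
    | notypeclasses refine (is_derive_expf _ _)
    | notypeclasses refine (is_derive_addf _ _)
    | notypeclasses refine (is_derive_oppf _)
    | notypeclasses refine (is_derive_sumf (fun=> _))
    | notypeclasses refine (is_derive_mulf _ _)
    | notypeclasses refine (is_derive_sinf _)
    | notypeclasses refine (is_derive_cosf _)
    | notypeclasses refine (is_derive_lnf _ _)
    | notypeclasses refine (is_derive_invf _ _) ]; try done
  | rewrite /= ].

Ltac derivable_continuous :=
  notypeclasses refine (is_derive_continuous _); derivation; reflexivity.

Section logarithm_series.
Context {R : realType}.
Implicit Types (u : R) (N : nat).

(** Follow t |-> u t for t in [0, 1]: the derivative of
    ln (1 - u t) + sum_(i <= N) (u t)^i / i is - u (u t)^N / (1 - u t), bounded by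
    K t^N, where K bounds 1 / (1 - u t) on the whole segment. The
    case u = -1 is the alternating harmonic series. *)
Lemma ln1B_series u N : -1 <= u < 1 ->
  `|ln (1 - u) + \sum_(i < N) u ^+ i.+1 / i.+1%:R| <= ((1 - u)^-1 + 1) / N.+1%:R.
Proof.
move=> /andP[u_ge u_lt].
pose K := (1 - u)^-1 + 1.
have pos t : 0 <= t <= 1 -> 0 < 1 - u * t by move=> /andP[t0 t1]; nra.
have Kge t : 0 <= t <= 1 -> (1 - u * t)^-1 <= K.
  move=> t01; have p := pos _ t01; have /andP[t0 t1] := t01.
  have u1 : 0 < 1 - u by lra.
  have [u0|u0] := leP 0 u.
    apply: le_trans (_ : (1 - u)^-1 <= K); last by rewrite /K lerDl.
    by rewrite lef_pV2 ?posrE//; nra.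
  apply: le_trans (_ : 1 <= K); last by rewrite /K lerDr invr_ge0 ltW.
  by rewrite invf_le1//; nra.
have := @norm_is_derive_le R
  (fun t => ln (1 - u * t) + \sum_(i < N) (u * t) ^+ i.+1 / i.+1%:R)
  (fun t => t ^+ N.+1 * (K / N.+1%:R))
  (fun t => - u * (u * t) ^+ N / (1 - u * t)) (fun t => t ^+ N * K) 0 1 ler01.
rewrite expr1n mul1r expr0n mul0r mulr0 subr0 ln1 add0r mulr1.
have -> : \sum_(i < N) 0 ^+ i.+1 / i.+1%:R = 0 :> R.
  by rewrite big1// => i _; rewrite expr0n mul0r.
rewrite !subr0; apply.
- move=> t t01; have p := pos _ t01.
  derivation.
  have -> : \sum_(i < N) ((u * t) ^+ i.+1 * 0 +
      i.+1%:R^-1 * (i.+1%:R * (u * t) ^+ i * (u * 1 + t * 0))) =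
      u * \sum_(i < N) (u * t) ^+ i.
    rewrite mulr_sumr; apply: eq_bigr => i _.
    rewrite mulr0 add0r mulr1 mulr0 addr0 mulrA mulrA mulVf ?pnatr_eq0// mul1r.
    by rewrite mulrC.
  have := subrX1 (u * t) N.
  set S := \sum_(i < N) _ => e.
  have -> : S = (1 - (u * t) ^+ N) / (1 - u * t).
    by apply: (mulIf (lt0r_neq0 p)); rewrite divfK ?gt_eqF//; lra.
  by field; rewrite gt_eqF.
- move=> t t01; derivation.
  by rewrite mulr0 add0r mulr1; field; rewrite -[1+_](natrD _ 1 N) pnatr_eq0.
- move=> t t01; have p := pos _ t01; have /andP[t0 t1] := t01.
  rewrite normrM normrM normrN exprMn normrM (ger0_norm (exprn_ge0 N t0)).
  rewrite (gtr0_norm (_ : 0 < (1 - u * t)^-1)) ?invr_gt0//.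
  have u1 : `|u| <= 1 by rewrite ler_norml u_ge ltW.
  rewrite mulrA -normrM -exprS.
  apply: ler_pM => //; [by rewrite mulr_ge0// exprn_ge0| by rewrite invr_ge0 ltW| |exact: Kge].
  by rewrite ler_piMl ?exprn_ge0// normrX exprn_ile1.
Qed.

End logarithm_series.

(** * The Fourier series of the logarithm of the sine *)

Section sine_estimates.
Context {R : realType}.
Implicit Types (x y : R) (N n : nat).

Lemma sin_sqr_le y : sin y ^+ 2 <= y ^+ 2.
Proof.
have h z : 0 <= z -> `|sin z| <= z :> R.
  move=> z0; have := @norm_is_derive_le R sin id cos (fun=> 1) 0 z z0.
  rewrite sin0 !subr0; apply=> t _; exact: cos_max.
suff : `|sin y| <= `|y| by rewrite -ler_sqr ?nnegrE// !real_normK ?num_real.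
have [y0|y0] := leP 0 y; first by rewrite (ger0_norm y0) h.
by rewrite (ltr0_norm y0) -normrN -sinN h// oppr_ge0 ltW.
Qed.

Lemma mul_cos_le_sin y : 0 <= y <= pi / 2 -> y * cos y <= sin y.
Proof.
move=> /andP[y0 ypi].
have := @ge0_is_derive_le R (fun t => sin t - t * cos t) (fun t => t * sin t) 0 y y0.
rewrite sin0 mul0r subrr subr_ge0; apply => x /andP[x0 xy].
  by derivation; ring.
rewrite mulr_ge0// sin_ge0_pi// x0/=.
by have := @pi_ge0 R; lra.
Qed.

(** From t cos t <= sin t at t = y/2:
    sin y = 2 sin (y/2) cos (y/2) >= y cos^2 (y/2) = y (1 + cos y) / 2 >= y / 2. *)
Lemma half_le_sin y : 0 <= y <= pi / 2 -> y / 2 <= sin y.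
Proof.
move=> /andP[y0 ypi].
have pi0 := @pi_ge0 R.
have c0 : 0 <= cos y by apply: cos_ge0_pihalf; lra.
have h : 0 <= y / 2 <= pi / 2 by lra.
have := mul_cos_le_sin h.
have ch0 : 0 <= cos (y / 2) by apply: cos_ge0_pihalf; lra.
have e : y / 2 + y / 2 = y by lra.
have := sinD (y / 2) (y / 2); have := cosD (y / 2) (y / 2); rewrite e.
have := cos2Dsin2 (y / 2).
move: (cos (y / 2)) (sin (y / 2)) (sin y) (cos y) ch0 c0 => c s S C *; nra.
Qed.

(** Each term 2 sin y sin (2 n y) is cos ((2n-1) y) - cos ((2n+1) y). *)
Lemma sum_sin_even y N :
  2 * sin y * (\sum_(i < N) sin (2 * i.+1%:R * y)) =
  cos y - cos ((2 * N%:R + 1) * y).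
Proof.
elim: N => [|N IH]; first by rewrite big_ord0 !mulr0 add0r mul1r subrr.
rewrite big_ord_recr/= mulrDr IH.
have -> : (2 * N.+1%:R + 1) * y = 2 * N.+1%:R * y + y by ring.
have -> : (2 * N%:R + 1) * y = 2 * N.+1%:R * y - y by rewrite -(natr1 N); ring.
rewrite cosB cosD; ring.
Qed.

Lemma cos_even_half_pi n : cos (2 * n%:R * (pi / 2)) = (-1) ^+ n :> R.
Proof.
have -> : 2 * n%:R * (pi / 2) = 0 + pi *+ n :> R by rewrite -mulr_natr add0r; field.
by rewrite (alternatingn (@cosDpi R)) cos0 mulr1.
Qed.

Lemma cos_series_half_pi N :
  `|\sum_(i < N) cos (2 * i.+1%:R * (pi / 2)) / i.+1%:R + ln 2| <= 2 / N.+1%:R :> R.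
Proof.
have h : -1 <= (-1 : R) < 1 by rewrite lexx/=; lra.
have := ln1B_series N h.
under eq_bigr do rewrite -cos_even_half_pi.
rewrite opprK -[1 + 1]/2 addrC => /le_trans; apply.
by rewrite ler_pM2r ?invr_gt0 ?ltr0n//; lra.
Qed.

(** With M = 2 N + 1, the function
    sum_n cos (2 n t) / n + ln (sin t) - sin (M t) / (M sin t)
    has derivative sin (M t) cos t / (M sin^2 t): the kernel sum_n sin (2 n t)
    and the cotangent cancel. That is bounded by the derivative of
    - 1 / (M sin t), so the function varies by at most 1 / (M sin y) between y
    and pi / 2, where the series is the alternating harmonic one. *)
Lemma cos_series_left N y : 0 < y <= pi / 2 ->
  `|\sum_(i < N) cos (2 * i.+1%:R * y) / i.+1%:R + ln (2 * sin y)|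
  <= 4 / (N.+1%:R * sin y).
Proof.
move=> /andP[y0 ypi].
have pi0 := @pi_gt0 R.
have sin_pos t : y <= t <= pi / 2 -> 0 < sin t.
  by move=> /andP[yt tpi]; apply: sin_gt0_pi; lra.
set M : R := 2 * N%:R + 1.
have M0 : 0 < M by rewrite /M; have := ler0n R N; lra.
pose C t := \sum_(i < N) cos (2 * i.+1%:R * t) / i.+1%:R : R.
have key := @norm_is_derive_le R
  (fun t => C t + ln (sin t) - sin (M * t) / (M * sin t))
  (fun t => - (M * sin t)^-1)
  (fun t => sin (M * t) * cos t / (M * sin t ^+ 2))
  (fun t => cos t / (M * sin t ^+ 2)) y (pi / 2) ypi.
have {key} : `|C (pi / 2) + ln (sin (pi / 2)) - sin (M * (pi / 2)) / (M * sin (pi / 2))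
  - (C y + ln (sin y) - sin (M * y) / (M * sin y))| <=
  - (M * sin (pi / 2))^-1 - - (M * sin y)^-1.
  apply: key => t tpi; have s0 := sin_pos _ tpi; have sn0 : sin t != 0 by rewrite gt_eqF.
  - have Mn0 : M != 0 by rewrite gt_eqF.
    have Ms : M * sin t != 0 by rewrite mulf_neq0.
    rewrite /C; derivation.
    have -> : \sum_(i < N) (cos (2 * i.+1%:R * t) * 0 + i.+1%:R^-1 *
        (- sin (2 * i.+1%:R * t) * (2 * i.+1%:R * 1 + t * 0))) =
        - (2 * \sum_(i < N) sin (2 * i.+1%:R * t)).
      rewrite mulr_sumr -sumrN; apply: eq_bigr => i _.
      by field; rewrite -[1+_](natrD _ 1 i) pnatr_eq0.
    have -> : 2 * (\sum_(i < N) sin (2 * i.+1%:R * t)) =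
        (cos t - cos (M * t)) / sin t.
      apply: (mulIf sn0); rewrite divfK// -sum_sin_even; ring.
    by field; rewrite sn0 Mn0.
  - have Ms : M * sin t != 0 by rewrite mulf_neq0// gt_eqF.
    derivation.
    by field; rewrite sn0 gt_eqF.
  - have c0 : 0 <= cos t by apply: cos_ge0_pihalf; have /andP[] := tpi; lra.
    have D0 : 0 <= cos t / (M * sin t ^+ 2).
      by rewrite divr_ge0 ?mulr_ge0 ?exprn_ge0 ?(ltW M0) ?(ltW s0).
    rewrite -mulrA normrM (ger0_norm D0) ler_piMl// sin_max//.
have := sin_max (M * (pi / 2)); have := sin_max (M * y).
have sy0 : 0 < sin y by apply: sin_pos; rewrite lexx.
have sy1 := sin_le1 y.
have := cos_series_half_pi N; rewrite -/(C (pi / 2)) -/(C y).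
rewrite sin_pihalf ln1 addr0 mulr1 lnM ?posrE//.
rewrite !invfM.
have NM : M^-1 <= N.+1%:R^-1 :> R.
  by rewrite lef_pV2 ?posrE// /M -natr1; have := ler0n R N; lra.
have M1 : 0 < M^-1 by rewrite invr_gt0.
have Z1 : 1 <= (sin y)^-1 by rewrite invf_ge1.
rewrite !ler_norml.
move: (C (pi / 2)) (C y) (sin (M * (pi / 2))) (sin (M * y)) (ln (sin y)) (ln 2).
move: (sin y)^-1 (M^-1) (N.+1%:R^-1) NM M1 Z1 => z m n nm m0 z1 c d s s' l l2.
move=> /andP[h1 h2] /andP[h3 h4] /andP[h5 h6] /andP[h7 h8].
have mz : 0 < m * z by nra.
have nz : m * z <= n * z by nra.
have nn : n <= n * z by nra.
have sm : - m <= s * m <= m by apply/andP; split; nra.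
have smz : - (m * z) <= s' * (m * z) <= m * z by apply/andP; split; nra.
by apply/andP; split; lra.
Qed.

(** Both sides are invariant under x |-> 1 - x, so x <= 1/2 suffices. *)
Lemma cos_series_bound N x : 0 < x < 1 ->
  `|\sum_(i < N) cos (2 * pi * i.+1%:R * x) / i.+1%:R + ln (2 * sin (pi * x))|
  <= 4 / (N.+1%:R * sin (pi * x)).
Proof.
move=> /andP[x0 x1]; have pi0 := @pi_gt0 R.
have [xle|xgt] := leP x (1 / 2).
  have h : 0 < pi * x <= pi / 2 by apply/andP; split; nra.
  have -> : \sum_(i < N) cos (2 * pi * i.+1%:R * x) / i.+1%:R =
            \sum_(i < N) cos (2 * i.+1%:R * (pi * x)) / i.+1%:R.
    by apply: eq_bigr => i _; congr (cos _ / _); ring.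
  exact: cos_series_left.
have h : 0 < pi * (1 - x) <= pi / 2 by apply/andP; split; nra.
have sE : sin (pi * (1 - x)) = sin (pi * x).
  by rewrite mulrBr mulr1 sinB sinpi cospi; ring.
have -> : \sum_(i < N) cos (2 * pi * i.+1%:R * x) / i.+1%:R =
          \sum_(i < N) cos (2 * i.+1%:R * (pi * (1 - x))) / i.+1%:R.
  apply: eq_bigr => i _; congr (_ / _).
  have -> : 2 * i.+1%:R * (pi * (1 - x)) =
      - (2 * pi * i.+1%:R * x) + (pi *+ 2) *+ i.+1.
    by rewrite -[in RHS]mulr_natr -[pi *+ 2]mulr_natr; ring.
  by rewrite (periodicn (@cosD2pi R)) cosN.
by rewrite -sE; exact: cos_series_left.
Qed.

Lemma inv_sin_le x : 0 < x < 1 -> (sin (pi * x))^-1 <= x^-1 + (1 - x)^-1.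
Proof.
move=> /andP[x0 x1]; have pi2 := @pi_ge2 R.
have y0 : 0 < 1 - x by lra.
have half (z : R) : 0 < z <= 1 / 2 -> (sin (pi * z))^-1 <= z^-1.
  move=> /andP[z0 z1]; have := @half_le_sin (pi * z).
  have -> : 0 <= pi * z <= pi / 2 by apply/andP; split; nra.
  by move=> /(_ isT) h; rewrite lef_pV2 ?posrE//; nra.
have [xle|xgt] := leP x (1 / 2).
  have h : 0 < x <= 1 / 2 by rewrite x0.
  by apply: (le_trans (half _ h)); rewrite lerDl invr_ge0 ltW.
have <- : sin (pi * (1 - x)) = sin (pi * x).
  by rewrite mulrBr mulr1 sinB sinpi cospi; ring.
have h : 0 < 1 - x <= 1 / 2 by lra.
by apply: (le_trans (half _ h)); rewrite lerDr invr_ge0 ltW.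
Qed.

End sine_estimates.

(** * Wallis integrals and the sine product *)

Section wallis_integral.
Context {R : realType}.
Implicit Types (x t : R) (n m K : nat).
Let lam := @lebesgue_measure R.

Let halfpi_gt0 : 0 < pi / 2 :> R. Proof. by have := @pi_gt0 R; lra. Qed.

Let cont f := forall t : R, {for t, continuous (f : R -> R)}.

Let continuous_integrable (f : R -> R) : cont f ->
  lam.-integrable `[0, pi / 2] (EFin \o f).
Proof.
move=> cf; apply: continuous_compact_integrable; first exact: segment_compact.
exact: continuous_subspaceT.
Qed.

Let ftc (F f : R -> R) : cont f -> (forall t, is_derive t 1 F (f t)) ->
  \int[lam]_(t in `[0, pi / 2]) f t = F (pi / 2) - F 0.
Proof.
move=> cf dF.
have cF t : F @ t --> F t by exact: is_derive_continuous (dF t).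
rewrite /Rintegral (@continuous_FTC2 R f F 0 (pi / 2))//.
- exact: continuous_subspaceT.
- split=> [t _||].
  + by have h := dF t; exact: ex_derive.
  + by apply: cvg_at_right_filter; exact: cF.
  + by apply: cvg_at_left_filter; exact: cF.
- by move=> t _; exact: is_derive_derive1.
Qed.

(** At x = 0 these are the Wallis integrals; their dependence on x produces the
    sine product. *)
Definition wallis n x : R :=
  \int[lam]_(t in `[0, pi / 2]) (cos t ^+ n * cos (2 * x * t)).

Let cont_wallis n x : cont (fun t => cos t ^+ n * cos (2 * x * t)).
Proof.
move=> t; derivable_continuous.
Qed.

Lemma wallis0 x : x != 0 -> wallis 0 x = sin (pi * x) / (2 * x).
Proof.
move=> x0; rewrite /wallis.
have dF t : is_derive t 1 (fun t => sin (2 * x * t) / (2 * x))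
    (cos t ^+ 0 * cos (2 * x * t)) by derivation; field.
rewrite (ftc (@cont_wallis 0 x) dF) mulr0 sin0 mul0r subr0.
by rewrite (_ : 2 * x * (pi / 2) = pi * x)//; field.
Qed.

Lemma wallis00 : wallis 0 0 = pi / 2.
Proof.
have dF t : is_derive t 1 (fun t => t) (cos t ^+ 0 * cos (2 * 0 * t)).
  by rewrite mulr0 mul0r cos0 expr0 mulr1; exact: is_derive_idf.
by rewrite /wallis (ftc (@cont_wallis 0 0) dF) subr0.
Qed.

(** The Wronskian of cos^(n+2) t and cos (2 x t) vanishes at 0 and pi / 2, and
    its derivative combines the integrands of wallis n x and wallis n.+2 x. *)
Lemma wallisSS n x :
  (n.+2%:R ^+ 2 - 4 * x ^+ 2) * wallis n.+2 x = n.+2%:R * n.+1%:R * wallis n x.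
Proof.
pose F t := - n.+2%:R * cos t ^+ n.+1 * sin t * cos (2 * x * t)
            + 2 * x * cos t ^+ n.+2 * sin (2 * x * t).
pose f t := n.+2%:R * n.+1%:R * (cos t ^+ n * cos (2 * x * t)) +
            (4 * x ^+ 2 - n.+2%:R ^+ 2) * (cos t ^+ n.+2 * cos (2 * x * t)).
have dF t : is_derive t 1 F (f t).
  rewrite /F /f; derivation.
  transitivity (n.+2%:R * n.+1%:R * cos t ^+ n * sin t ^+ 2 * cos (2 * x * t) +
      (4 * x ^+ 2 - n.+2%:R) * cos t ^+ n.+2 * cos (2 * x * t)).
    rewrite (exprS _ n.+1) (exprS _ n).
    by move: (cos t ^+ n) (cos t) (sin t) (sin _) (cos _) => p c s S C; ring.
  rewrite sin2cos2 (exprS _ n.+1) (exprS _ n) -[n.+2%:R]natr1.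
  by move: (cos t ^+ n) (cos t) (cos _) n.+1%:R => p c C M; ring.
have cf : cont f.
  by rewrite /f => t; derivable_continuous.
have := ftc cf dF; rewrite /F /f RintegralD//=; last 2 first.
- apply: (continuous_integrable (f := fun t => _ * (cos t ^+ n * cos (2 * x * t)))).
  by move=> t; derivable_continuous.
- apply: (continuous_integrable (f := fun t => _ * (cos t ^+ n.+2 * cos (2 * x * t)))).
  by move=> t; derivable_continuous.
rewrite !RintegralZl//; try exact: continuous_integrable.
rewrite -!/(wallis _ _) cos_pihalf sin0 !expr0n/= !(mulr0, mul0r, addr0, subr0, sin0) => h.
by lra.
Qed.

Lemma wallis_even_gt0 K : 0 < wallis K.*2 0.
Proof.
elim: K => [|K IH]; first by rewrite wallis00.
have := wallisSS K.*2 0; rewrite expr0n mulr0 subr0 doubleS => e.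
have : 0 < K.*2.+2%:R ^+ 2 * wallis K.*2.+2 0.
  by rewrite e mulr_gt0// mulr_gt0// ltr0n.
by rewrite pmulr_rgt0// exprn_gt0// ltr0n.
Qed.

Let le_Rint (f g : R -> R) : cont f -> cont g ->
  (forall t, 0 <= t <= pi / 2 -> f t <= g t) ->
  \int[lam]_(t in `[0, pi / 2]) f t <= \int[lam]_(t in `[0, pi / 2]) g t.
Proof.
move=> cf cg fg; apply: le_Rintegral => //; exact: continuous_integrable.
Qed.

Lemma wallis_le n x : wallis n x <= wallis n 0.
Proof.
apply: le_Rint; [exact: cont_wallis|exact: cont_wallis|move=> t t01].
rewrite mulr0 mul0r cos0 ler_wpM2l ?cos_le1// exprn_ge0// cos_ge0_pihalf//.
by have /andP[] := t01; have := halfpi_gt0; lra.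
Qed.

(** cos (2 x t) >= 1 - 2 x^2 t^2 and t cos t <= sin t bound the defect
    wallis n.+2 0 - wallis n.+2 x by 2 x^2 times the integral of
    sin^2 cos^n, which the recurrence evaluates. *)
Lemma wallis_ge n x :
  (1 - 2 * x ^+ 2 / n.+1%:R) * wallis n.+2 0 <= wallis n.+2 x.
Proof.
have e : (1 - 2 * x ^+ 2 / n.+1%:R) * wallis n.+2 0 =
         (1 + 2 * x ^+ 2) * wallis n.+2 0 - 2 * x ^+ 2 * wallis n 0.
  have := wallisSS n 0; rewrite expr0n mulr0 subr0 -natr1.
  have : n.+1%:R != 0 :> R by rewrite pnatr_eq0.
  have : n.+1%:R + 1 != 0 :> R by rewrite natr1 pnatr_eq0.
  move: n.+1%:R (wallis n.+2 0) (wallis n 0) => m v w m1 m0 h.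
  have {}h : (m + 1) * v = m * w by apply: (mulfI m1); rewrite mulrA -expr2 h; ring.
  have -> : w = (m + 1) * v / m by rewrite h; field.
  by field.
rewrite e /wallis -!RintegralZl//; try exact: continuous_integrable.
rewrite -RintegralB//; last 2 first.
- apply: (continuous_integrable (f := fun t => _ * (cos t ^+ n.+2 * cos (2 * 0 * t)))).
  by move=> t; derivable_continuous.
- apply: (continuous_integrable (f := fun t => _ * (cos t ^+ n * cos (2 * 0 * t)))).
  by move=> t; derivable_continuous.
apply: le_Rint.
- by move=> t; derivable_continuous.
- exact: cont_wallis.
move=> t /andP[t0 t1]; rewrite mulr0 mul0r cos0 !mulr1.
have pi0 := halfpi_gt0.
have c0 : 0 <= cos t by apply: cos_ge0_pihalf; lra.
have h : t * cos t <= sin t by apply: mul_cos_le_sin; rewrite t0.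
have s2 : sin t ^+ 2 = 1 - cos t ^+ 2 by exact: sin2cos2.
have s0 : 0 <= t * cos t by rewrite mulr_ge0.
have tc : (t * cos t) ^+ 2 <= 1 - cos t ^+ 2 by rewrite -s2 !expr2; nra.
have cg : 1 - 2 * x ^+ 2 * t ^+ 2 <= cos (2 * x * t).
  have -> : 2 * x * t = x * t + x * t by ring.
  have := sin_sqr_le (x * t); have := cos2Dsin2 (x * t); rewrite cosD; nra.
rewrite (exprS _ n.+1) (exprS _ n).
have p0 : 0 <= cos t ^+ n by rewrite exprn_ge0.
have x2 : 0 <= x ^+ 2 by rewrite sqr_ge0.
move: (cos t) (cos t ^+ n) (cos (2 * x * t)) (x ^+ 2) p0 c0 cg tc x2 => c p C z p0 c0 cg tc z0.
have h1 : c ^+ 2 * p * (1 - 2 * z * t ^+ 2) <= c ^+ 2 * p * C.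
  by rewrite ler_wpM2l ?mulr_ge0 ?sqr_ge0.
have h2 : z * p * ((t * c) ^+ 2) <= z * p * (1 - c ^+ 2).
  by rewrite ler_wpM2l ?mulr_ge0 ?sqr_ge0.
by move: h1 h2; rewrite !expr2; lra.
Qed.

(** The recurrences at x and at 0 differ by the factor 1 - x^2 / k^2 when
    n + 2 = 2 k; iterate from wallis 0. *)
Lemma wallis_product K x : x != 0 ->
  sin (pi * x) / (pi * x) =
  (\prod_(k < K) (1 - (x / k.+1%:R) ^+ 2)) * (wallis K.*2 x / wallis K.*2 0).
Proof.
move=> x0; elim: K => [|K ->].
  have p0 : pi != 0 :> R by rewrite gt_eqF// pi_gt0.
  rewrite big_ord0 mul1r wallis0// wallis00.
  by move: (@pi R) p0 (sin _) => p p0 s; field; rewrite x0 p0.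
rewrite big_ord_recr/= -mulrA; congr (_ * _).
have := wallisSS K.*2 x; have := wallisSS K.*2 0.
rewrite expr0n mulr0 subr0 doubleS.
have := wallis_even_gt0 K; have := wallis_even_gt0 K.+1; rewrite doubleS.
have : K.*2.+1%:R != 0 :> R by rewrite pnatr_eq0.
have -> : K.*2.+2%:R = 2 * K.+1%:R :> R by rewrite -natrM mul2n doubleS.
have : K.+1%:R != 0 :> R by rewrite pnatr_eq0.
move: K.+1%:R K.*2.+1%:R (wallis K.*2.+2 0) (wallis K.*2.+2 x).
move: (wallis K.*2 0) (wallis K.*2 x) => w0 w k m v0 v k0 m0.
move=> /lt0r_neq0 v00 /lt0r_neq0 w00 h0 h.
have -> : w = ((2 * k) ^+ 2 - 4 * x ^+ 2) * v / (2 * k * m).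
  by rewrite h; field; rewrite k0 m0.
have -> : w0 = (2 * k) ^+ 2 * v0 / (2 * k * m).
  by rewrite h0; field; rewrite k0 m0.
by field; rewrite k0 m0 v00.
Qed.

(** Euler's product for the sine, in logarithmic form: the last factor of
    wallis_product tends to 1, squeezed between wallis_ge and wallis_le. *)
Lemma ln_sin_product x : 0 < x < 1 ->
  series (fun k => ln (1 - (x / k.+1%:R) ^+ 2)) @ \oo -->
  ln (sin (pi * x)) - ln (pi * x).
Proof.
move=> /andP[x0 x1]; have pi0 := @pi_gt0 R.
have xn0 : x != 0 by rewrite gt_eqF.
have s0 : 0 < sin (pi * x) by apply: sin_gt0_pi; apply/andP; split; nra.
have px0 : 0 < pi * x by rewrite mulr_gt0.
pose r K := wallis K.*2 x / wallis K.*2 0.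
have f0 k : 0 < 1 - (x / k.+1%:R) ^+ 2.
  rewrite subr_gt0 expr_lt1// ?divr_ge0 ?(ltW x0)//.
  by rewrite ltr_pdivrMr// mul1r (lt_le_trans x1)// ler1n.
have P0 K : 0 < \prod_(k < K) (1 - (x / k.+1%:R) ^+ 2) by apply: prodr_gt0.
have r0 K : 0 < r K.
  have : 0 < sin (pi * x) / (pi * x) by rewrite divr_gt0.
  by rewrite (wallis_product K xn0) pmulr_rgt0.
have lnP K : ln (\prod_(k < K) (1 - (x / k.+1%:R) ^+ 2)) =
    series (fun k => ln (1 - (x / k.+1%:R) ^+ 2)) K.
  rewrite seriesEord /=; elim: K => [|K IH]; first by rewrite !big_ord0 ln1.
  by rewrite !big_ord_recr/= lnM ?posrE ?P0 ?f0// IH.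
have eK K : series (fun k => ln (1 - (x / k.+1%:R) ^+ 2)) K =
    ln (sin (pi * x)) - ln (pi * x) - ln (r K).
  by rewrite -ln_div ?posrE// (wallis_product K xn0) lnM ?posrE ?P0 ?r0// lnP addrK.
rewrite (funext eK).
rewrite -[X in _ --> X]subr0 -(@ln1 R).
apply: cvgB; first exact: cvg_cst.
suff rc : r @ \oo --> (1 : R).
  by apply: (cvg_comp _ _ rc); exact: (@continuous_ln R 1 ltr01).
rewrite -cvg_shiftS.
apply: (@squeeze_cvgr _ _ _ _ (fun n => 1 - 2 * x ^+ 2 * n.+1%:R^-1) (fun=> 1)).
- near=> n; apply/andP; split; last first.
    by rewrite /r ler_pdivrMr ?wallis_even_gt0// mul1r wallis_le.
  rewrite /r ler_pdivlMr ?wallis_even_gt0// doubleS.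
  apply: le_trans (wallis_ge _ _).
  rewrite ler_wpM2r//; first by rewrite -doubleS ltW// wallis_even_gt0.
  have x2 : 0 <= 2 * x ^+ 2 by rewrite mulr_ge0 ?sqr_ge0.
  rewrite lerD2l lerN2; apply: ler_wpM2l => //.
  by rewrite lef_pV2 ?posrE ?ltr0n// ler_nat ltnS -addnn leq_addr.
- rewrite -[X in _ --> X]subr0; apply: cvgB; first exact: cvg_cst.
  rewrite -(mulr0 (2 * x ^+ 2)); apply: cvgM; first exact: cvg_cst.
  exact: cvg_harmonic.
- exact: cvg_cst.
Unshelve. all: by end_near. Qed.

End wallis_integral.

(** * Functional equations of the question mark function and invariance of its measure *)

Section question_mark_symmetries.
Context {R : realType}.
Implicit Types (x y t : R) (n : nat).

(** x |-> x / (1 + x) adds 1 to the first partial quotient. *)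
Lemma question_mark_farey0 x : 0 <= x <= 1 ->
  question_mark (x / (1 + x)) = question_mark x / 2.
Proof.
move=> /andP[x0 x1]; have [->|xn0] := eqVneq x 0.
  by rewrite mul0r question_mark0 mul0r.
have x01 : 0 < x <= 1 by rewrite lt0r xn0 x0.
have [a0 t01 xE] := gauss_mapP x01.
have [y01 ay gy] := gauss_mapV (ltn0Sn (partial_quotient x 0)) t01.
have -> : x / (1 + x) = ((partial_quotient x 0).+1%:R + gauss_map x)^-1.
  have -> : (partial_quotient x 0).+1%:R + gauss_map x = 1 + x^-1.
    by rewrite {3}xE invrK -natr1; ring.
  have xp : 0 < x by rewrite lt0r xn0.
  by field; do ?[apply/andP; split]; apply/lt0r_neq0; lra.
rewrite (question_markE y01) ay gy (question_markE x01) exprS invfM.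
by field; rewrite expf_neq0.
Qed.

(** x |-> 1 / (1 + x) inserts a partial quotient 1 in front. *)
Lemma question_mark_farey1 x : 0 <= x <= 1 ->
  question_mark (1 + x)^-1 = 1 - question_mark x / 2.
Proof.
move=> /andP[x0]; rewrite le_eqVlt => /predU1P[->|x1].
  have h : 0 <= (1 : R) <= 1 by rewrite ler01 lexx.
  by have := question_mark_farey0 h; rewrite mul1r question_mark1 => ->; lra.
have x01 : 0 <= x < 1 by rewrite x0.
have [y01 ay gy] := gauss_mapV (ltn0Sn 0) x01.
by rewrite (question_markE y01) ay gy expr1; lra.
Qed.

(** For y >= 1/2 write y = 1 / (1 + t); then 1 - y = t / (1 + t), and the two
    previous functional equations compare the values. *)
Lemma question_mark_onem x : 0 <= x <= 1 ->
  question_mark (1 - x) = 1 - question_mark x.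
Proof.
have half y : 1 / 2 <= y <= 1 -> question_mark (1 - y) = 1 - question_mark y :> R.
  move=> /andP[y0 y1].
  have t01 : 0 <= (1 - y) / y <= 1.
    by rewrite ler_pdivrMr ?divr_ge0//; lra.
  have yn0 : y != 0 by apply/lt0r_neq0; lra.
  have e1 : 1 + (1 - y) / y = y^-1 by field.
  have := question_mark_farey1 t01; have := question_mark_farey0 t01.
  by rewrite e1 invrK divfK// => -> ->; lra.
move=> /andP[x0 x1]; have [h|h] := leP (1 / 2) x; first by rewrite half// h.
have /half : 1 / 2 <= 1 - x <= 1 by lra.
by rewrite opprB addrC subrK => ->; lra.
Qed.

Lemma question_mark_inv_nat n : question_mark n.+1%:R^-1 = 2^-1 ^+ n :> R.
Proof.
have h : 0 <= (0 : R) < 1 by rewrite lexx ltr01.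
have [y01 ay gy] := gauss_mapV (ltn0Sn n) h.
rewrite addr0 in y01 ay gy.
by rewrite (question_markE y01) ay gy question_mark0 subr0 mulrC exp2VS exprVn.
Qed.

Lemma question_mark_ext01 x : 0 <= x <= 1 -> question_mark_ext x = question_mark x.
Proof. by move=> /andP[x0 x1]; rewrite /question_mark_ext min_l// max_r. Qed.

Lemma question_mark_ext_le0 x : x <= 0 -> question_mark_ext x = 0.
Proof.
move=> x0; rewrite /question_mark_ext min_l ?(le_trans x0)// max_l//.
exact: question_mark0.
Qed.

Lemma question_mark_ext_ge1 x : 1 <= x -> question_mark_ext x = 1.
Proof.
move=> x1; rewrite /question_mark_ext min_r// max_r//.
exact: question_mark1.
Qed.

Lemma question_mark_ext_onem x : question_mark_ext (1 - x) = 1 - question_mark_ext x.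
Proof.
have [x0|x0] := leP x 0.
  by rewrite question_mark_ext_ge1 ?question_mark_ext_le0//; lra.
have [x1|x1] := leP 1 x.
  by rewrite question_mark_ext_le0 ?question_mark_ext_ge1//; lra.
rewrite !question_mark_ext01 ?question_mark_onem//; lra.
Qed.

Lemma cvg_question_mark_extNy : @question_mark_ext R @ -oo --> (0 : R).
Proof.
apply: cvg_near_cst; near=> x; apply: question_mark_ext_le0.
by near: x; apply: nbhs_ninfty_le; exact: num_real.
Unshelve. all: by end_near. Qed.

Lemma cvg_question_mark_exty : @question_mark_ext R @ +oo --> (1 : R).
Proof.
apply: cvg_near_cst; near=> x; apply: question_mark_ext_ge1.
by near: x; apply: nbhs_pinfty_ge; exact: num_real.
Unshelve. all: by end_near. Qed.

HB.instance Definition _ := isCumulativeBounded.Build R 0 1 (@question_mark_ext R)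
  cvg_question_mark_extNy cvg_question_mark_exty.

End question_mark_symmetries.

Section question_mark_law.
Context {R : realType}.
Implicit Types (x y t : R) (n : nat).
Let mu := question_mark_measure R.
Let F := @question_mark_ext R.
Let P : probability (measurableTypeR R) R :=
  lebesgue_stieltjes_measure (@question_mark_ext R).

Lemma question_mark_measureNyc t : mu `]-oo, t]%classic = (F t)%:E.
Proof. exact: (cdf_lebesgue_stieltjes_id (@question_mark_ext R) t). Qed.

Let measure_oy t : mu `]t, +oo[%classic = (1 - F t)%:E.
Proof.
have h : P [set` `]-oo, t]] = (F t)%:E := question_mark_measureNyc t.
have := @probability_setC _ _ _ P [set` `]-oo, t]] (measurable_itv _).
by rewrite h setCitvl.
Qed.

Let F_left n t : exists2 y, y < t & F t - 2 ^- n <= F y.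
Proof.
have e0 : 0 <= (2 : R) ^- n by rewrite invr_ge0 exprn_ge0.
have [t0|t0] := leP t 0.
  exists (t - 1); first lra.
  by rewrite /F !question_mark_ext_le0//; lra.
have [t1|t1] := ltP 1 t.
  by exists 1 => //; rewrite /F !question_mark_ext_ge1//; lra.
have t01 : 0 < t <= 1 by rewrite t0.
have [y /andP[y0 yt] h] := (question_mark_approx R n).2 t t01.
exists y => //; rewrite /F !question_mark_ext01 ?y0 ?(ltW t0)//.
by rewrite (le_trans (ltW yt)).
Qed.

(** There are no atoms, because ? is left continuous. *)
Lemma question_mark_measurecy t : mu `[t, +oo[%classic = (1 - F t)%:E.
Proof.
apply/eqP; rewrite eq_le; apply/andP; split; last first.
  rewrite -measure_oy; apply: le_measure; rewrite ?inE//.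
  by apply: subset_itvr; rewrite bnd_simp.
have h n : (mu `[t, +oo[%classic <= (1 - F t)%:E + (2 ^- n)%:E)%E.
  have [y yt hy] := F_left n t.
  apply: (@le_trans _ _ (mu `]y, +oo[%classic)).
    apply: le_measure; rewrite ?inE//.
    by apply: subset_itvr; rewrite bnd_simp.
  by rewrite measure_oy -EFinD lee_fin; lra.
apply/lee_addgt0Pr => e e0.
have [n ne] : exists n, (2 : R) ^- n <= e.
  exists (Num.truncn e^-1).
  rewrite -[leRHS]invrK lef_pV2 ?posrE ?exprn_gt0 ?invr_gt0//.
  have eV0 : 0 <= e^-1 by rewrite invr_ge0 ltW.
  have /andP[_ /ltW/le_trans] := truncn_itv eV0; apply.
  by rewrite -natrX ler_nat ltn_expl.
by apply: (le_trans (h n)); rewrite leeD2l// lee_fin.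
Qed.

Lemma question_mark_measureT : mu setT = 1%E.
Proof. exact: (@probability_setT _ _ _ P). Qed.

Lemma question_mark_measure_setC01 : mu (~` `]0, 1[) = 0.
Proof.
apply/eqP; rewrite -measure_le0.
apply: (@le_trans _ _ (mu (`]-oo, 0] `|` `[1, +oo[))).
  apply: le_measure; rewrite ?inE//; first exact: measurableC.
    exact: measurableU.
  move=> x /=; rewrite !in_itv/= andbT => h.
  have [x0|x0] := leP x 0; [by left|right].
  by rewrite leNgt; apply/negP => x1; apply: h; rewrite x0.
apply: le_trans (measureU2 _ _ _) _ => //.
rewrite [X in (X + _)%E]question_mark_measureNyc [X in (_ + X)%E]question_mark_measurecy.
by rewrite /F question_mark_ext_le0// question_mark_ext_ge1// subrr adde0.
Qed.

(** A finite measure on the line is determined by its distribution function. *)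
Lemma question_mark_measure_invariant (phi : measurableTypeR R -> measurableTypeR R) :
  measurable_fun setT phi ->
  (forall t, mu (phi @^-1` [set` `]-oo, t]]) = (F t)%:E) ->
  forall A, measurable A -> mu A = pushforward mu phi A.
Proof.
move=> mphi phiF A mA.
pose phi' : {mfun measurableTypeR R >-> measurableTypeR R} :=
  HB.pack phi (isMeasurableFun.Build _ _ _ _ phi mphi).
have fin (B : set (measurableTypeR R)) : measurable B -> (mu B < +oo)%E.
  move=> mB; apply: (@le_lt_trans _ _ (mu setT)).
    by apply: le_measure; rewrite ?inE.
  by rewrite question_mark_measureT ltry.
have mpre (B : set (measurableTypeR R)) : measurable B -> measurable (phi @^-1` B).
  by move=> mB; have := mphi measurableT B mB; rewrite setTI.
have itvD (a b : R) : `]a, b]%classic = `]-oo, b] `\` `]-oo, a].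
  apply/seteqP; split=> x /=; rewrite !in_itv/= ltNge.
    by move=> /andP[/negP].
  by move=> [-> /negP ->].
have itvI (a b : R) : a < b -> `]-oo, b] `&` `]-oo, a] = `]-oo, a]%classic.
  move=> ab; apply/seteqP; split=> x /=; rewrite !in_itv/=; first by case.
  by move=> xa; split=> //; rewrite (le_trans xa)// ltW.
apply: (@lebesgue_stieltjes_measure_unique R _ (pushforward mu phi')) => //.
move=> X /ocitvP[->|[[a b]/= ab ->]]; first by rewrite !measure0.
rewrite itvD; transitivity ((F b)%:E - (F a)%:E)%E.
  have e := @measureD _ _ _ mu _ _ (measurable_itv `]-oo, b]) (measurable_itv `]-oo, a])
    (fin _ (measurable_itv _)).
  apply: (eq_trans e); rewrite itvI//.
  by congr (_ - _)%E; exact: question_mark_measureNyc.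
have e := @measureD _ _ _ mu _ _ (mpre _ (measurable_itv `]-oo, b]))
  (mpre _ (measurable_itv `]-oo, a])) (fin _ (mpre _ (measurable_itv _))).
apply/esym; apply: (eq_trans e); rewrite -preimage_setI itvI//.
by congr (_ - _)%E; exact: phiF.
Qed.

(** The tent map x / (1 - x) on [0, 1/2], (1 - x) / x on [1/2, 1] of the Farey
    expansion. Its two inverse branches on [0, 1] are x / (1 + x) and 1 / (1 + x).
    Written with min and max it is continuous on the whole line. *)
Definition farey_tent x := Num.min x (1 - x) / Num.max x (1 - x).

Let max_gt0 x : 0 < Num.max x (1 - x).
Proof. by rewrite lt_max; have [x0|x0] := ltP 0 x => //=; lra. Qed.

Lemma measurable_onem : measurable_fun setT (fun x : R => 1 - x).
Proof. by apply: measurable_funB. Qed.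

Lemma measurable_farey_tent : measurable_fun setT farey_tent.
Proof.
apply: continuous_measurable_fun => x.
have ci : {for x, continuous (fun y : R => y)} by exact: cvg_id.
have co : {for x, continuous (fun y : R => 1 - y)}.
  by apply: cvgB; [exact: cvg_cst|exact: cvg_id].
apply: cvgM; first exact: (continuous_min ci co).
by apply: cvgV; [rewrite gt_eqF|exact: (continuous_max ci co)].
Qed.

Lemma question_mark_measure_onem A : measurable A ->
  mu A = pushforward mu (fun x : R => 1 - x) A.
Proof.
apply: question_mark_measure_invariant; first exact: measurable_onem.
move=> t; have -> : (fun x : R => 1 - x) @^-1` [set` `]-oo, t]] = [set` `[1 - t, +oo[].
  by apply/seteqP; split=> x /=; rewrite !in_itv/= andbT; lra.
by rewrite question_mark_measurecy /F question_mark_ext_onem subKr.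
Qed.

Lemma farey_tent_le x t : 0 <= t < 1 ->
  (farey_tent x <= t) = (x <= t / (1 + t)) || ((1 + t)^-1 <= x).
Proof.
move=> /andP[t0 t1]; rewrite /farey_tent ler_pdivrMr//.
rewrite ler_pdivlMr ?(lt_le_trans ltr01) ?lerDl//.
rewrite -div1r ler_pdivrMr ?(lt_le_trans ltr01) ?lerDl//.
have [h|h] := leP x (1 - x).
  apply/idP/orP=> [|[]]; [left| |]; nra.
by apply/idP/orP=> [|[]]; [right| |]; nra.
Qed.

(** For 0 <= t < 1, the preimage of ]-oo, t] has one component at each end of
    [0, 1], and the functional equations give each of them mass ?(t) / 2. *)
Lemma question_mark_measure_farey_tent A : measurable A ->
  mu A = pushforward mu farey_tent A.
Proof.
apply: question_mark_measure_invariant; first exact: measurable_farey_tent.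
move=> t; have [t0|t0] := ltP t 0.
  rewrite /F question_mark_ext_le0 ?ltW//.
  apply: subset_measure0 question_mark_measure_setC01.
  - by rewrite -[X in measurable X]setTI; exact: measurable_farey_tent.
  - exact: measurableC.
  move=> x /=; rewrite !in_itv/= => h /andP[x0 x1].
  have : 0 <= farey_tent x by rewrite divr_ge0 ?(ltW (max_gt0 x))// le_min; lra.
  lra.
have [t1|t1] := leP 1 t.
  rewrite /F question_mark_ext_ge1// -question_mark_measureT; congr (mu _).
  apply/seteqP; split=> x //= _; rewrite in_itv/= (le_trans _ t1)//.
  by rewrite ler_pdivrMr ?max_gt0// mul1r ge_min le_max lexx.
have t01 : 0 <= t < 1 by rewrite t0.
have -> : farey_tent @^-1` [set` `]-oo, t]] =
    [set` `]-oo, t / (1 + t)]] `|` [set` `[(1 + t)^-1, +oo[].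
  apply/seteqP; split=> x /=; rewrite !in_itv/= andbT farey_tent_le//.
    by move/orP.
  by move=> h; apply/orP.
have s0 : 0 < 1 + t by lra.
rewrite measureU//; last first.
  apply/seteqP; split=> x //= []; rewrite !in_itv/= andbT => h1 h2.
  by have := le_trans h2 h1; rewrite ler_pdivlMr// mulVf ?gt_eqF//; lra.
transitivity ((F (t / (1 + t)))%:E + (1 - F (1 + t)^-1)%:E)%E.
  congr (_ + _)%E; [exact: question_mark_measureNyc|exact: question_mark_measurecy].
rewrite -EFinD /F.
have a01 : 0 <= t / (1 + t) <= 1 by rewrite divr_ge0 ?ler_pdivrMr//; lra.
have b01 : 0 <= (1 + t)^-1 <= 1 by rewrite invr_ge0 ?invf_le1//; lra.
have t01' : 0 <= t <= 1 by rewrite t0 ltW.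
rewrite !question_mark_ext01// question_mark_farey0// question_mark_farey1//.
by congr (_%:E); lra.
Qed.

End question_mark_law.

(** * The power series of the sine product *)

Section nonnegative_series.
Context {R : realType}.
Implicit Types (u : R^nat) (l : R).

Lemma cvg_series_nneseries u l : series u @ \oo --> l ->
  (\sum_(0 <= k <oo) (u k)%:E)%E = l%:E.
Proof.
move=> ul; apply: cvg_lim => //; apply: cvg_EFin.
  by apply: nearW => n; rewrite sumEFin.
by apply: cvg_trans ul; apply: near_eq_cvg; apply: nearW => n; rewrite /= sumEFin.
Qed.

Lemma nneseries_cvg_series u l : (forall k, 0 <= u k) ->
  (\sum_(0 <= k <oo) (u k)%:E)%E = l%:E -> series u @ \oo --> l.
Proof.
move=> u0 ul.
have c : cvgn (fun n => (\sum_(0 <= k < n) (u k)%:E)%E).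
  by apply: is_cvg_nneseries => k _ _; rewrite lee_fin.
move: c => /cvg_ex[/= m c].
have e : m = l%:E by rewrite -ul; apply/esym/cvg_lim.
rewrite e in c; move/fine_cvg : c; apply: cvg_trans; apply: near_eq_cvg.
by apply: nearW => n; rewrite /= sumEFin.
Qed.

(** Tonelli for double series of nonnegative reals. *)
Lemma cvg_series_interchange (a : nat -> nat -> R) (r c : R^nat) l :
  (forall i j, 0 <= a i j) ->
  (forall i, series (a i) @ \oo --> r i) -> series r @ \oo --> l ->
  (forall j, series (a ^~ j) @ \oo --> c j) ->
  series c @ \oo --> l.
Proof.
move=> a0 ar rl ac; apply: nneseries_cvg_series => [j|].
  rewrite -(cvg_lim _ (ac j))//; apply: limr_ge; first exact: cvgP (ac j).
  by apply: nearW => n; rewrite /series/= sumr_ge0.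
rewrite -(cvg_series_nneseries rl).
under eq_eseriesr => j _ do rewrite -(cvg_series_nneseries (ac j)).
under [RHS]eq_eseriesr => i _ do rewrite -(cvg_series_nneseries (ar i)).
by rewrite nneseries_interchange// => i j; rewrite lee_fin.
Qed.

Lemma cvg_series_shift1 u l : series u @ \oo --> l ->
  series (fun k => u k.+1) @ \oo --> l - u 0%N.
Proof.
move=> ul; have -> : series (fun k => u k.+1) = fun n => series u n.+1 - u 0%N.
  by apply/funext => n; rewrite !seriesEnat/= big_nat_recl// addrC addKr.
apply: cvgB; last exact: cvg_cst.
by rewrite cvg_shiftS.
Qed.

End nonnegative_series.

Section sine_product_power_series.
Context {R : realType}.
Implicit Types (x v : R) (n k : nat).

Lemma cvg_ln1B_series v : -1 <= v < 1 ->
  series (fun n => v ^+ n.+1 / n.+1%:R) @ \oo --> - ln (1 - v).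
Proof.
move=> v1; apply/cvgrPdist_le => e e0; near=> n.
rewrite seriesEord/= -opprD normrN.
apply: le_trans (ln1B_series n v1) _.
have K0 : 0 < (1 - v)^-1 + 1.
  by rewrite addr_gt0// invr_gt0; have /andP[] := v1; lra.
rewrite ler_pdivrMr ?ltr0n// mulrC -ler_pdivrMr// -natr1.
rewrite (@le_trans _ _ n%:R) ?lerDl//.
by near: n; exact: nbhs_infty_ger.
Unshelve. all: by end_near. Qed.

(** The limit that defines zeta exists at every even positive integer: for k >= 2,
    compare k^-s with 1/(k-1) - 1/k. *)
Lemma cvg_zeta n :
  series (fun k => (k.+1%:R : R) ^- (2 * n.+1)) @ \oo --> zeta (2 * n.+1)%:R.
Proof.
have zE : (fun k => (k.+1%:R : R) `^ (- (2 * n.+1)%:R)) =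
          (fun k => k.+1%:R ^- (2 * n.+1)).
  by apply/funext => k; rewrite powR_invn.
rewrite /zeta zE; set u := fun k => _.
have u0 k : 0 <= u k by rewrite /u invr_ge0 exprn_ge0.
apply: nondecreasing_is_cvgn.
  by apply: nondecreasing_series => k _ _; exact: u0.
have bound K : series u K.+1 <= 2 - K.+1%:R^-1.
  elim: K => [|K IH].
    by rewrite seriesEord/= big_ord1 /u expr1n invr1; lra.
  have -> : series u K.+2 = series u K.+1 + u K.+1.
    by rewrite !seriesEord/= [LHS]big_ord_recr.
  have h : u K.+1 <= K.+1%:R^-1 - K.+2%:R^-1.
    have a0 : 0 < K.+1%:R :> R by rewrite ltr0n.
    have b0 : 0 < K.+2%:R :> R by rewrite ltr0n.
    have -> : K.+1%:R^-1 - K.+2%:R^-1 = (K.+1%:R * K.+2%:R)^-1 :> R.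
      by rewrite -(natr1 K.+1) in b0 *; field; rewrite !gt_eqF.
    rewrite lef_pV2 ?posrE ?exprn_gt0 ?mulr_gt0//.
    apply: (@le_trans _ _ (K.+2%:R ^+ 2)).
      by rewrite expr2 ler_pM2r// ler_nat.
    by rewrite ler_weXn2l ?ler1n// mulnS.
  by have := lerD IH h; rewrite addrA subrK.
exists 2 => _ [[|K] _ <-]; first by rewrite seriesEord/= big_ord0.
apply: (le_trans (bound K)); rewrite lerBlDr lerDl invr_ge0//.
Qed.

(** By the sine product this is - sum_(k >= 2) ln (1 - x^2 / k^2), the part of
    - ln (sin (pi x)) that stays bounded on ]0, 1[. *)
Definition ln_sinc_tail x : R :=
  - ln (sin (pi * x)) + ln (pi * x) + ln (1 - x ^+ 2).

(** Expand every logarithm of the sine product with k >= 2 and sum over k first. *)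
Lemma cvg_ln_sinc_tail x : 0 < x < 1 ->
  series (fun n => (zeta (2 * n.+1)%:R - 1) / n.+1%:R * x ^+ (2 * n.+1)) @ \oo -->
  ln_sinc_tail x.
Proof.
move=> /[dup] x01 /andP[x0 x1].
pose v k := (x / k.+2%:R) ^+ 2.
have v01 k : -1 <= v k < 1.
  rewrite (le_trans _ (sqr_ge0 _))/=; last by lra.
  rewrite expr_lt1 ?divr_ge0 ?(ltW x0)// ltr_pdivrMr// mul1r.
  by rewrite (lt_le_trans x1)// ler1n.
apply: (@cvg_series_interchange R (fun k n => v k ^+ n.+1 / n.+1%:R)
  (fun k => - ln (1 - v k))).
- by move=> k n; rewrite divr_ge0// exprn_ge0// sqr_ge0.
- by move=> k; exact: cvg_ln1B_series.
- have := cvg_series_shift1 (ln_sin_product x01).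
  rewrite divr1 => /cvgN; rewrite (_ : - (_ - _) = ln_sinc_tail x); last first.
    by rewrite /ln_sinc_tail; ring.
  apply: cvg_trans; apply: near_eq_cvg; apply: nearW => n.
  by rewrite /series/= fctE sumrN.
- move=> n; have := cvg_series_shift1 (@cvg_zeta n).
  rewrite expr1n invr1 => h.
  have {h} : x ^+ (2 * n.+1) / n.+1%:R * series (fun k => k.+2%:R ^- (2 * n.+1)) K
      @[K --> \oo] --> x ^+ (2 * n.+1) / n.+1%:R * (zeta (2 * n.+1)%:R - 1).
    by apply: cvgMl_tmp; exact: h.
  rewrite (_ : _ * (_ - 1) = (zeta (2 * n.+1)%:R - 1) / n.+1%:R * x ^+ (2 * n.+1));
    last by ring.
  apply: cvg_trans; apply: near_eq_cvg; apply: nearW => K.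
  rewrite /series/= mulr_sumr; apply: eq_bigr => k _.
  by rewrite /v -exprM expr_div_n; ring.
Qed.

End sine_product_power_series.

(** * Integration against the question mark measure *)

Section question_mark_integral.
Context {R : realType}.
Implicit Types (f g : R -> R) (x : R) (n : nat).
Let mu := question_mark_measure R.
Let U : set R := [set` `]0, 1[].
Let V : set R := [set` `]0, 1]].

Let mU : measurable (U : set (measurableTypeR R)). Proof. exact: measurable_itv. Qed.
Let mV : measurable (V : set (measurableTypeR R)). Proof. exact: measurable_itv. Qed.
Let UV : U `<=` V.
Proof. by move=> x; rewrite /U /V /= !in_itv/= => /andP[-> /ltW]. Qed.

Let setT_D : [set: measurableTypeR R] `\` ~` U = U.
Proof. by rewrite setTD setCK. Qed.

Let mCU : measurable (~` U : set (measurableTypeR R)).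
Proof. exact: measurableC. Qed.

Definition qm_integrable f :=
  (question_mark_measure R).-integrable [set` `]0, 1[] (EFin \o f).

Definition qm_integral f : R :=
  \int[question_mark_measure R]_(x in [set` `]0, 1[]) f x.

(** Invariance of d? under phi, for integrals over ]0, 1[. Only null sets separate
    ]0, 1[, its preimage under phi and the line, so f is replaced by its extension
    by zero. The point 1 is kept in the range because the tent map takes the
    value 1 at 1/2. *)
Lemma qm_integral_comp (phi : measurableTypeR R -> measurableTypeR R) f :
  measurable_fun setT phi ->
  (forall A, measurable A -> mu A = pushforward mu phi A) ->
  (forall x, U x -> V (phi x)) -> measurable_fun V f -> qm_integrable f ->
  qm_integrable (f \o phi) /\ qm_integral (f \o phi) = qm_integral f.
Proof.
move=> mphi inv UVphi mf intf.
pose g : measurableTypeR R -> \bar R := EFin \o (f \_ V).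
have mg : measurable_fun setT g.
  by apply/measurable_EFinP; apply/(measurable_restrictT f mV).
have gf : {in U, g =1 EFin \o f}.
  by move=> x; rewrite inE => /UV xV; rewrite /g /= patchE mem_set.
have gphi : {in U, g \o phi =1 EFin \o (f \o phi)}.
  by move=> x; rewrite inE => /UVphi xV; rewrite /g /= patchE mem_set.
have mgphi : measurable_fun setT (g \o phi) by exact: measurableT_comp.
have CU0 := @question_mark_measure_setC01 R.
have intgT : mu.-integrable setT g.
  apply/(negligible_integrable mCU measurableT mg CU0); rewrite setT_D.
  by apply: eq_integrable intf => // x xU; rewrite gf.
pose phi' : {mfun measurableTypeR R >-> measurableTypeR R} :=
  HB.pack phi (isMeasurableFun.Build _ _ _ _ phi mphi).
have push (h : measurableTypeR R -> \bar R) :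
  (\int[pushforward mu phi]_x h x = \int[mu]_x h x)%E.
  apply: (@eq_measure_integral _ _ _ setT mu (pushforward mu phi')) => A mA _.
  by rewrite [RHS]inv.
have intgphiT : mu.-integrable setT (g \o phi).
  apply/integrableP; split => //.
  have /integrableP[_] := intgT; rewrite -push ge0_integral_pushforward//.
  exact: measurableT_comp.
split.
  have /(negligible_integrable mCU measurableT mgphi CU0) := intgphiT.
  by rewrite setT_D; apply: eq_integrable.
rewrite /qm_integral /Rintegral; congr fine.
transitivity (\int[mu]_(x in U) (g \o phi) x)%E.
  by apply: eq_integral => x xU; rewrite gphi.
rewrite -setT_D -(negligible_integral mCU measurableT intgphiT CU0).
have := integral_pushforward mphi mg intgphiT measurableT.
rewrite preimage_setT => <-; rewrite push.
rewrite (negligible_integral mCU measurableT intgT CU0) setT_D.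
by apply: eq_integral => x xU; rewrite gf.
Qed.

Lemma qm_integrableD f g : qm_integrable f -> qm_integrable g ->
  qm_integrable (fun x => f x + g x).
Proof. by move=> fi gi; exact: (integrableD mU fi gi). Qed.

Lemma qm_integrableZ (c : R) f : qm_integrable f -> qm_integrable (fun x => c * f x).
Proof. by move=> fi; exact: (integrableZl mU c fi). Qed.

Lemma qm_integralD f g : qm_integrable f -> qm_integrable g ->
  qm_integral (fun x => f x + g x) = qm_integral f + qm_integral g.
Proof. by move=> fi gi; exact: RintegralD. Qed.

Lemma qm_integralZ (c : R) f : qm_integrable f ->
  qm_integral (fun x => c * f x) = c * qm_integral f.
Proof. by move=> fi; exact: RintegralZl. Qed.

Lemma eq_qm_integral f g : (forall x, 0 < x < 1 -> f x = g x) ->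
  qm_integral f = qm_integral g.
Proof. by move=> fg; apply: eq_Rintegral => x; rewrite inE /U /= in_itv/= => /fg. Qed.

Lemma qm_integrable_le f g : measurable_fun U f ->
  (forall x, 0 < x < 1 -> `|f x| <= g x) -> qm_integrable g -> qm_integrable f.
Proof.
move=> mf fg; apply: le_integrable => //; first exact/measurable_EFinP.
move=> x; rewrite /U /= in_itv/= => /fg h.
by rewrite lee_fin (le_trans h)// ler_norm.
Qed.

Lemma eq_qm_integrable f g : (forall x, 0 < x < 1 -> f x = g x) ->
  qm_integrable f -> qm_integrable g.
Proof.
move=> fg; apply: eq_integrable => // x; rewrite inE /U /= in_itv/= => /fg.
by rewrite /= => ->.
Qed.

Lemma qm_measure_U : mu U = 1%E.
Proof.
have e : (mu (U `|` ~` U) = mu U + mu (~` U))%E.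
  by apply: measureU => //; rewrite setICr.
have h : mu (~` U) = 0%E by exact: question_mark_measure_setC01.
by move: e; rewrite h adde0 setUCr => <-; exact: question_mark_measureT.
Qed.

Lemma qm_integrable_cst (c : R) : qm_integrable (fun=> c).
Proof.
pose P : probability (measurableTypeR R) R :=
  lebesgue_stieltjes_measure (@question_mark_ext R).
exact: (@finite_measure_integrable_cst _ _ _ P U c).
Qed.

Lemma qm_integral_cst (c : R) : qm_integral (fun=> c) = c.
Proof.
by rewrite /qm_integral Rintegral_cst// qm_measure_U mulr1.
Qed.

End question_mark_integral.

(** * Integrals of logarithms *)

Section question_mark_logarithms.
Context {R : realType}.
Implicit Types (f g : R -> R) (x : R) (n : nat).
Let mu := question_mark_measure R.
Let U : set R := [set` `]0, 1[].
Let V : set R := [set` `]0, 1]].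

Let mU : measurable (U : set (measurableTypeR R)). Proof. exact: measurable_itv. Qed.

(** ?(1/k) = 2^(1-k) makes the tail of 1/x summable: 1/x is at most one plus
    the number of integers k >= 1 with x <= 1/k. *)
Lemma qm_integrable_inv : qm_integrable (fun x => x^-1).
Proof.
have minv : measurable_fun (U : set (measurableTypeR R)) (fun x : R => x^-1).
  apply: open_continuous_measurable_fun; first exact: interval_open.
  move=> x; rewrite inE /U /= in_itv/= => /andP[x0 _].
  by apply: inv_continuous; rewrite gt_eqF.
apply/integrableP; split; first exact/measurable_EFinP.
pose I k : set (measurableTypeR R) := [set` `]-oo, k.+1%:R^-1]].
have mI k : measurable (I k) by exact: measurable_itv.
have mind k : measurable_fun (U : set (measurableTypeR R)) (EFin \o \1_(I k) : _ -> \bar R).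
  by apply/measurable_EFinP; exact: measurable_indic.
apply: (@le_lt_trans _ _ (\int[mu]_(x in U) (1 + \sum_(0 <= k <oo) (\1_(I k) x)%:E))%E).
  apply: ge0_le_integral => //.
  - by apply: measurableT_comp => //; exact/measurable_EFinP.
  - apply: emeasurable_funD => //; apply: ge0_emeasurable_sum => //.
    by move=> k _; exact: mind.
  move=> x; rewrite /U /= in_itv/= => /andP[x0 x1].
  have xV0 : 0 <= x^-1 by rewrite invr_ge0 ltW.
  have /andP[lo hi] := truncn_itv xV0.
  rewrite ger0_norm//; set N := Num.truncn x^-1 in lo hi *.
  apply: (@le_trans _ _ (1 + \sum_(0 <= k < N) (\1_(I k) x)%:E)%E); last first.
    by rewrite leeD2l//; apply: nneseries_lim_ge => k _ _; rewrite lee_fin.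
  rewrite (_ : \sum_(0 <= k < N) _ = N%:R%:E)%E.
    by rewrite -EFinD lee_fin addrC natr1 ltW.
  rewrite sumEFin big_mkord (eq_bigr (fun=> 1)) ?sumr_const ?card_ord// => k _.
  rewrite indicE mem_set// /I /= in_itv/= -[x]invrK lef_pV2 ?posrE ?invr_gt0//.
  by apply: le_trans lo; rewrite ler_nat.
have I0 k x : (0 <= (\1_(I k) x)%:E :> \bar R)%E by rewrite lee_fin.
rewrite ge0_integralD//; last 2 first.
- by move=> x _; apply: nneseries_ge0.
- by apply: ge0_emeasurable_sum => // k _; exact: mind.
rewrite integral_cst// mul1e integral_nneseries//.
apply: lte_add_pinfty; first by rewrite qm_measure_U ltry.
have h : series (fun k => 2^-1 ^+ k) @ \oo --> (1 * (1 - 2^-1)^-1 : R).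
  have := @cvg_geometric_series R 1 2^-1; rewrite ger0_norm// => /(_ _).
  rewrite (_ : geometric 1 _ = fun k => 2^-1 ^+ k); first by apply; lra.
  by apply/funext => k /=; rewrite mul1r.
apply: (@le_lt_trans _ _ (\sum_(0 <= k <oo) (2^-1 ^+ k)%:E)%E); last first.
  by rewrite (cvg_series_nneseries h) ltry.
apply: lee_nneseries => [k _ _|k _]; first exact: integral_ge0.
rewrite integral_indic// setIC.
apply: (@le_trans _ _ (mu (I k))).
  by apply: le_measure; rewrite ?inE//; exact: measurableI.
rewrite [X in (X <= _)%E]question_mark_measureNyc question_mark_ext01.
  by rewrite question_mark_inv_nat.
by rewrite invr_ge0 ler0n/= invf_le1 ?ltr0n// ler1n.
Qed.

Let onem_UV x : U x -> V (1 - x).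
Proof. rewrite /U /V /= !in_itv/=; lra. Qed.

Lemma qm_onem f : measurable_fun V f -> qm_integrable f ->
  qm_integrable (fun x => f (1 - x)) /\
  qm_integral (fun x => f (1 - x)) = qm_integral f.
Proof.
move=> mf intf.
exact: (qm_integral_comp (@measurable_onem R) (@question_mark_measure_onem R) onem_UV mf intf).
Qed.

Lemma qm_farey_tent f : measurable_fun V f -> qm_integrable f ->
  qm_integrable (fun x => f (farey_tent x)) /\
  qm_integral (fun x => f (farey_tent x)) = qm_integral f.
Proof.
move=> mf intf.
apply: (qm_integral_comp (@measurable_farey_tent R)
  (@question_mark_measure_farey_tent R) _ mf intf).
move=> x; rewrite /U /V /= !in_itv/= => /andP[x0 x1].
have M0 : 0 < Num.max x (1 - x) by rewrite lt_max x0.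
rewrite divr_gt0 ?lt_min ?x0 ?subr_gt0//=.
by rewrite ler_pdivrMr// mul1r ge_min le_max lexx.
Qed.

Lemma qm_integrable_inv_onem : qm_integrable (fun x => x^-1 + (1 - x)^-1).
Proof.
apply: qm_integrableD; first exact: qm_integrable_inv.
apply: (proj1 (@qm_onem (fun x => x^-1) _ qm_integrable_inv)).
have : measurable_fun ([set` `]0, +oo[] : set (measurableTypeR R)) (fun x : R => x^-1).
  apply: open_continuous_measurable_fun; first exact: interval_open.
  move=> x; rewrite inE /= in_itv/= => /andP[x0 _].
  by apply: inv_continuous; rewrite gt_eqF.
apply: measurable_funS; first exact: measurable_itv.
by move=> x; rewrite /V /= !in_itv/= => /andP[->].
Qed.

Lemma qm_integrable_ln : qm_integrable (@ln R).
Proof.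
apply: (qm_integrable_le _ _ qm_integrable_inv).
  by apply: measurable_funTS; exact: measurable_ln.
move=> x /andP[x0 x1]; rewrite ler0_norm ?ln_le0 ?ltW//.
rewrite -lnV ?posrE//; apply: ln_sublinear; rewrite invr_gt0//.
Qed.

Let measurable_ln1D (D : set R) : measurable_fun D (fun x => ln (1 + x)).
Proof.
apply: measurable_funTS; apply: measurableT_comp; first exact: measurable_ln.
exact: measurable_funD.
Qed.

Lemma qm_integrable_ln1D : qm_integrable (fun x => ln (1 + x)).
Proof.
apply: (qm_integrable_le _ _ (qm_integrable_cst 1)); first exact: measurable_ln1D.
move=> x /andP[x0 x1]; rewrite ger0_norm; last by rewrite ln_ge0// lerDl ltW.
by rewrite (le_trans (le_ln1Dx _))//; lra.
Qed.

(** On ]0, 1[, ln x + ln (1 - x) = ln (T x) - 2 ln (1 + T x) for the Farey tent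
    map T, since {x, 1 - x} = {m, M} with T x = m / M and 1 + T x = 1 / M. *)
Lemma qm_integral_ln :
  qm_integral (@ln R) = - 2 * qm_integral (fun x => ln (1 + x)).
Proof.
have mln D : measurable_fun D (@ln R) by apply: measurable_funTS; exact: measurable_ln.
have iln := qm_integrable_ln; have iln1D := qm_integrable_ln1D.
have [i1 e1] := qm_onem (mln V) iln.
have [i2 e2] := qm_farey_tent (mln V) iln.
have [i3 e3] := qm_farey_tent (@measurable_ln1D V) iln1D.
have : qm_integral (fun x => ln x + ln (1 - x)) =
       qm_integral (fun x => ln (farey_tent x) + - 2 * ln (1 + farey_tent x)).
  apply: eq_qm_integral => x /andP[x0 x1]; rewrite /farey_tent.
  have y0 : 0 < 1 - x by lra.
  have aux (m M : R) : 0 < m -> 0 < M -> m + M = 1 ->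
      ln m + ln M = ln (m / M) + - 2 * ln (1 + m / M).
    move=> m0 M0 mM; have -> : 1 + m / M = M^-1.
      apply: (mulIf (lt0r_neq0 M0)).
      by rewrite mulrDl mul1r divfK ?mulVf ?gt_eqF// addrC.
    by rewrite ln_div ?posrE// lnV ?posrE//; lra.
  have [h|h] := leP x (1 - x); first by rewrite aux//; lra.
  by rewrite [LHS]addrC aux//; lra.
rewrite qm_integralD// qm_integralD//; last exact: qm_integrableZ.
by rewrite qm_integralZ// e1 e2 e3; lra.
Qed.

End question_mark_logarithms.

(** * Termwise integration *)

Section termwise_integration.
Context {R : realType}.
Implicit Types (f g : R -> R) (x : R) (n : nat).
Let mu := question_mark_measure R.
Let U : set R := [set` `]0, 1[].
Let I01 : set R := [set` `[0, 1]].

Let mU : measurable (U : set (measurableTypeR R)). Proof. exact: measurable_itv. Qed.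

(** The end points have no mass. *)
Lemma bounded_qm_integrable f : measurable_fun setT f ->
  (forall x, 0 <= x <= 1 -> `|f x| <= 1) ->
  qm_integrable f /\ \int[mu]_(x in [set` `[0, 1]]) f x = qm_integral f.
Proof.
move=> mf f1.
have mI : measurable (I01 : set (measurableTypeR R)) by exact: measurable_itv.
have mCU : measurable (~` U : set (measurableTypeR R)) by exact: measurableC.
have UI : I01 `\` ~` U = U.
  rewrite setDE setCK; apply/seteqP; split=> x /=; first by case.
  by move=> h; split=> //; move: h; rewrite /I01 /= !in_itv/= => /andP[/ltW-> /ltW].
pose P : probability (measurableTypeR R) R :=
  lebesgue_stieltjes_measure (@question_mark_ext R).
have int1 : mu.-integrable I01 (EFin \o cst 1).
  exact: (@finite_measure_integrable_cst _ _ _ P I01 1).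
have intf : mu.-integrable I01 (EFin \o f).
  apply: le_integrable int1 => //; first by apply/measurable_EFinP; exact: measurable_funTS.
  by move=> x; rewrite /I01 /= in_itv/= => /f1; rewrite lee_fin normr1.
split.
  apply: (qm_integrable_le _ _ (qm_integrable_cst 1)); first exact: measurable_funTS.
  by move=> x /andP[x0 x1]; rewrite f1// !ltW.
rewrite /qm_integral /Rintegral; congr fine.
by rewrite (negligible_integral mCU mI intf (@question_mark_measure_setC01 R)) UI.
Qed.

Lemma momentP n : qm_integrable (fun x : R => x ^+ n) /\
  moment n = qm_integral (fun x => x ^+ n).
Proof.
apply: (@bounded_qm_integrable (fun x => x ^+ n)); first exact: measurable_funX.
by move=> x /andP[x0 x1]; rewrite normrX exprn_ile1// ger0_norm.
Qed.

Lemma fourier_coefP n : qm_integrable (fun x : R => cos (2 * pi * n%:R * x)) /\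
  fourier_coef n = qm_integral (fun x => cos (2 * pi * n%:R * x)).
Proof.
apply: (@bounded_qm_integrable (fun x => cos (2 * pi * n%:R * x))).
  by apply: continuous_measurable_fun => x; derivable_continuous.
by move=> x _; exact: cos_max.
Qed.

(** Monotone convergence: with nonnegative coefficients the integral of the sum is
    the sum of the integrals, and integrability of Q makes that sum finite. *)
Lemma cvg_series_moment (c : R^nat) (e : nat -> nat) (Q : R -> R) :
  (forall n, 0 <= c n) -> qm_integrable Q ->
  (forall x, 0 < x < 1 -> series (fun n => c n * x ^+ e n) @ \oo --> Q x) ->
  series (fun n => c n * moment (e n)) @ \oo --> qm_integral Q.
Proof.
move=> c0 iQ cQ.
have m0 n : 0 <= moment n :> R.
  rewrite (momentP n).2; apply: Rintegral_ge0 => x.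
  by rewrite /= in_itv/= => /andP[/ltW x0 _]; rewrite exprn_ge0.
have mX n : measurable_fun (U : set (measurableTypeR R)) (fun x => (c n * x ^+ e n)%:E).
  apply/measurable_EFinP; apply: measurable_funTS.
  have h : measurable_fun setT (fun x : R => x ^+ e n) by exact: measurable_funX.
  exact: (measurable_funM (measurable_cst (c n)) h).
apply: nneseries_cvg_series => [n|]; first by rewrite mulr_ge0.
have finQ : (\int[mu]_(x in U) (Q x)%:E)%E \is a fin_num.
  exact: (integrable_fin_num mU iQ).
rewrite /qm_integral /Rintegral fineK//.
transitivity (\int[mu]_(x in U) \sum_(0 <= n <oo) (c n * x ^+ e n)%:E)%E; last first.
  apply: eq_integral => x; rewrite inE /U /= in_itv/= => x01.
  by apply: cvg_series_nneseries; exact: cQ.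
rewrite integral_nneseries//; last first.
  move=> n x; rewrite /U /= in_itv/= => /andP[/ltW x0 _].
  by rewrite lee_fin mulr_ge0// exprn_ge0.
apply: eq_eseriesr => n _.
have [iX ->] := momentP (e n); rewrite -qm_integralZ// /qm_integral /Rintegral fineK//.
exact: (integrable_fin_num mU (qm_integrableZ (c n) iX)).
Qed.

End termwise_integration.

Section fourier_series.
Context {R : realType}.
Implicit Types (x : R) (n N : nat).

Let ln2sin x := ln (2 * sin (pi * x)).

Let measurable_ln2sin D : measurable_fun D ln2sin.
Proof.
apply: measurable_funTS; apply: measurableT_comp; first exact: measurable_ln.
by apply: continuous_measurable_fun => x; derivable_continuous.
Qed.

Let bound N x : 0 < x < 1 ->
  `|\sum_(i < N) cos (2 * pi * i.+1%:R * x) / i.+1%:R + ln2sin x|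
  <= 4 / N.+1%:R * (x^-1 + (1 - x)^-1).
Proof.
move=> x01; apply: (le_trans (cos_series_bound N x01)).
rewrite invfM mulrA; apply: ler_wpM2l; first by rewrite divr_ge0.
exact: inv_sin_le.
Qed.

(** The bound for the partial sums, at N = 0, already dominates this function. *)
Lemma qm_integrable_ln2sin : qm_integrable ln2sin.
Proof.
apply: (qm_integrable_le _ _ (qm_integrableZ 4 qm_integrable_inv_onem)).
  exact: measurable_ln2sin.
by move=> x x01; have := bound 0 x01; rewrite big_ord0 add0r divr1.
Qed.

(** The partial sums of sum_n cos (2 pi n x) / n approach - ln (2 sin (pi x)) at
    the rate 4 (1/x + 1/(1-x)) / (N+1), and 1/x + 1/(1-x) is integrable. *)
Lemma cvg_series_fourier_coef :
  series (fun n => fourier_coef n.+1 / n.+1%:R) @ \oo --> - qm_integral ln2sin.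
Proof.
pose S N x := \sum_(i < N) cos (2 * pi * i.+1%:R * x) / i.+1%:R : R.
have SP N : qm_integrable (S N) /\
    qm_integral (S N) = series (fun n => fourier_coef n.+1 / n.+1%:R) N.
  elim: N => [|N [iS eS]].
    have S0 x : 0 = S 0%N x by rewrite /S big_ord0.
    split; first by apply: eq_qm_integrable (qm_integrable_cst 0).
    by rewrite -(eq_qm_integral (f := fun=> 0))// qm_integral_cst seriesEord/= big_ord0.
  have SS x : S N x + N.+1%:R^-1 * cos (2 * pi * N.+1%:R * x) = S N.+1 x.
    by rewrite /S big_ord_recr/= [_^-1 * _]mulrC.
  have [ic dE] := @fourier_coefP R N.+1.
  have iN := qm_integrableZ (N.+1%:R^-1) ic.
  split; first by apply: eq_qm_integrable (qm_integrableD iS iN).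
  rewrite -(eq_qm_integral (f := fun x => S N x + N.+1%:R^-1 * cos (2 * pi * N.+1%:R * x)))//.
  rewrite qm_integralD// eS qm_integralZ// -dE.
  by rewrite !seriesEord/= big_ord_recr/= [_^-1 * _]mulrC.
have i2 := qm_integrable_ln2sin.
have iB := @qm_integrable_inv_onem R.
set B := qm_integral (fun x => x^-1 + (1 - x)^-1).
have key N : `|series (fun n => fourier_coef n.+1 / n.+1%:R) N + qm_integral ln2sin|
    <= 4 / N.+1%:R * B.
  have [iS <-] := SP N; rewrite -qm_integralD// /B -qm_integralZ//.
  have iSl := qm_integrableD iS i2.
  apply: le_trans (le_normr_Rintegral _ iSl) _; first exact: measurable_itv.
  apply: le_Rintegral; first exact: measurable_itv.
  - exact: (integrable_norm iSl).
  - exact: (qm_integrableZ _ iB).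
  - by move=> x; rewrite /= in_itv/= => x01; exact: bound.
apply/subr_cvg0 => /=; rewrite opprK; apply/norm_cvg0P.
apply: (@squeeze_cvgr _ _ _ _ (fun=> 0) (fun n => 4 / n.+1%:R * B)).
- by near=> N; rewrite normr_ge0/= key.
- exact: cvg_cst.
- rewrite -(mul0r B); apply: cvgM; last exact: cvg_cst.
  rewrite -(mulr0 4); apply: cvgM; first exact: cvg_cst.
  exact: cvg_harmonic.
Unshelve. all: by end_near. Qed.

End fourier_series.

(** * The three series *)

Section log_sine_integral.
Context {R : realType}.
Implicit Types (x : R) (n : nat).

Let J : R := qm_integral (fun x => ln (1 + x)).
Let S : R := qm_integral (fun x => ln (2 * sin (pi * x))).

(** The series is the integral of - ln (1 - x / 2) = ln 2 - ln (1 + (1 - x)), and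
    1 - x has the same law as x. *)
Lemma cvg_series_moment_half :
  series (fun n => moment n.+1 / (n.+1%:R * 2 ^+ n.+1)) @ \oo --> ln 2 - J.
Proof.
pose Q x : R := ln 2 + - 1 * ln (1 + (1 - x)).
have m1 : measurable_fun ([set` `]0, 1]] : set R) (fun x : R => ln (1 + x)).
  apply: measurable_funTS; apply: measurableT_comp; first exact: measurable_ln.
  exact: measurable_funD.
have [i1 e1] := qm_onem m1 (@qm_integrable_ln1D R).
have iQ : qm_integrable Q.
  by apply: qm_integrableD; [exact: qm_integrable_cst|exact: qm_integrableZ].
have <- : qm_integral Q = ln 2 - J.
  rewrite /Q qm_integralD ?qm_integral_cst ?qm_integralZ ?e1 ?mulN1r//.
    exact: qm_integrable_cst.
  exact: qm_integrableZ.
have -> : (fun n => moment n.+1 / (n.+1%:R * 2 ^+ n.+1)) =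
    (fun n => (n.+1%:R * 2 ^+ n.+1)^-1 * moment (n.+1)) :> R^nat.
  by apply/funext => n; rewrite mulrC.
apply: (@cvg_series_moment R (fun n => (n.+1%:R * 2 ^+ n.+1)^-1) succn) => //.
move=> x /andP[x0 x1].
have -> : Q x = - ln (1 - x / 2).
  rewrite /Q (_ : 1 - x / 2 = (1 + (1 - x)) / 2); last by field.
  by rewrite ln_div ?posrE//; lra.
have h : -1 <= x / 2 < 1 by lra.
have := cvg_ln1B_series h; apply: cvg_trans; apply: near_eq_cvg; apply: nearW => N.
rewrite /series/=; apply: eq_bigr => n _.
by rewrite expr_div_n invfM; ring.
Qed.

(** The series is the integral of ln_sinc_tail; the factor 3 collects ln (1 + x)
    itself and twice ln x, which qm_integral_ln turns into - 4 ln (1 + x). *)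
Lemma cvg_series_zeta_moment :
  series (fun n => (zeta (2 * n.+1)%:R - 1) * moment (2 * n.+1) / n.+1%:R) @ \oo -->
  ln 2 + ln pi - 3 * J - S.
Proof.
have pi0 := @pi_gt0 R.
have m1 : measurable_fun ([set` `]0, 1]] : set R) (@ln R).
  by apply: measurable_funTS; exact: measurable_ln.
have iln := @qm_integrable_ln R.
have iln1D := @qm_integrable_ln1D R.
have iS := @qm_integrable_ln2sin R.
have [iom eom] := qm_onem m1 iln.
pose Q x : R := ln 2 + ln pi + (ln x + (ln (1 - x) +
  (ln (1 + x) + - 1 * ln (2 * sin (pi * x))))).
have ic := @qm_integrable_cst R (ln 2 + ln pi).
have i4 := qm_integrableD iln1D (qm_integrableZ (- 1) iS).
have i3 := qm_integrableD iom i4.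
have i2 := qm_integrableD iln i3.
have iQ : qm_integrable Q := qm_integrableD ic i2.
have <- : qm_integral Q = ln 2 + ln pi - 3 * J - S.
  rewrite /Q (qm_integralD ic i2) qm_integral_cst (qm_integralD iln i3).
  rewrite (qm_integralD iom i4) eom.
  rewrite (qm_integralD iln1D (qm_integrableZ _ iS)) (qm_integralZ _ iS).
  by rewrite qm_integral_ln -/J -/S; ring.
have -> : (fun n => (zeta (2 * n.+1)%:R - 1) * moment (2 * n.+1) / n.+1%:R) =
    (fun n => ((zeta (2 * n.+1)%:R - 1) / n.+1%:R) * moment (2 * n.+1)) :> R^nat.
  by apply/funext => n; rewrite mulrAC.
apply: (@cvg_series_moment R (fun n => (zeta (2 * n.+1)%:R - 1) / n.+1%:R)
  (fun n => 2 * n.+1)%N) => //.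
  move=> n; rewrite divr_ge0//.
  have := cvg_series_shift1 (@cvg_zeta R n); rewrite expr1n invr1 => h.
  rewrite -(cvg_lim _ h)//; apply: limr_ge; first exact: cvgP h.
  by apply: nearW => K; rewrite /series/= sumr_ge0// => k _; rewrite invr_ge0 exprn_ge0.
move=> x /[dup] x01 /andP[x0 x1].
have -> : Q x = ln_sinc_tail x.
  have s0 : 0 < sin (pi * x) by apply: sin_gt0_pi; apply/andP; split; nra.
  rewrite /Q /ln_sinc_tail lnM ?posrE// lnM ?posrE//.
  have -> : 1 - x ^+ 2 = (1 - x) * (1 + x) by ring.
  by rewrite lnM ?posrE ?subr_gt0//; [ring|lra].
exact: cvg_ln_sinc_tail.
Qed.

End log_sine_integral.

Theorem proposition4 (R : realType) :
  let D : R^nat := fun n => fourier_coef n.+1 / n.+1%:R in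
  let A : R^nat := fun n =>
    (zeta (2 * n.+1)%:R - 1) * moment (2 * n.+1) / n.+1%:R in
  let B : R^nat := fun n => moment n.+1 / (n.+1%:R * 2 ^+ n.+1) in
  [/\ cvgn (series D), dirichlet_M 1 = limn (series D),
      cvgn (series A), cvgn (series B) &
      dirichlet_M (1 : R) =
        limn (series A) - 3 * limn (series B) - ln pi + ln 4].
Proof.
move=> D A B.
have cD := @cvg_series_fourier_coef R.
have cA := @cvg_series_zeta_moment R.
have cB := @cvg_series_moment_half R.
have DE : dirichlet_M (1 : R) = limn (series D).
  rewrite /dirichlet_M; congr (limn (series _)).
  by apply/funext => n; rewrite /D powR_inv1.
split=> //; [exact: cvgP cD|exact: cvgP cA|exact: cvgP cB|].
rewrite DE (cvg_lim _ cD)// (cvg_lim _ cA)// (cvg_lim _ cB)//.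
have -> : 4 = 2 ^+ 2 :> R by ring.
by rewrite lnXn// mulr2n; ring.
Qed.
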